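(* Let either $r_1,r_2\in\{\frac12,\frac13,\frac14,\frac16\}$ or $(r_1,r_2)\in\{(\frac15,\frac25),(\frac18,\frac38),(\frac1{10},\frac3{10}),(\frac1{12},\frac5{12})\}$, and let $d$ be the least common denominator of $r_1,r_2$. For $N=1,2,\dots$ put $$H(N;q)=\sum_{k=0}^{N-1}\frac{(q^{dr_1};q^d)_k\,(q^{d(1-r_1)};q^d)_k\,(q^{dr_2};q^d)_k\,(q^{d(1-r_2)};q^d)_k}{(q^d;q^d)_k^4}\,q^{dk}.$$ Then for all positive integers $A,B,n$ with $\gcd(n,d)=1$ and $n>1$, $$\frac{H(An;q)}{H(Bn;q)}\equiv\frac{H(A;q^{n^2})}{H(B;q^{n^2})}\pmod{\Phi_n(q)^3}.$$
   Context: Notation: $(a;q)_k=(1-a)(1-aq)\cdots(1-aq^{k-1})$ is the $q$-Pochhammer symbol, and $\Phi_n(q)$ is the $n$th cyclotomic polynomial. $H(N;q)$ is regarded as a rational function of $q$; $H(N;q^{n^2})$ is obtained from it by replacing $q$ by $q^{n^2}$. Congruences between rational functions: for polynomials $A_1(q),A_2(q),P(q)\in\mathbb Z[q]$, $A_1(q)/A_2(q)\equiv0\pmod{P(q)}$ means that $P(q)$ divides $A_1(q)$ and is coprime with $A_2(q)$; for rational functions $A(q),B(q)\in\mathbb Z(q)$, $A(q)\equiv B(q)\pmod{P(q)}$ means $A(q)-B(q)\equiv0\pmod{P(q)}$. *)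

(* Defs.v *)
From HB Require Import structures.
From mathcomp Require Import all_boot all_order all_algebra all_field.

Set Implicit Arguments.
Unset Strict Implicit.
Unset Printing Implicit Defensive.

Import GRing.Theory.
Local Open Scope ring_scope.

Notation Zq := {fraction {poly int}}.

Definition qvar : Zq := tofrac ('X : {poly int}).

(* Divisibility in Z[q] itself: the %| of polydiv on {poly int} is
   pseudo-divisibility, i.e. divisibility in Q[q]. *)
Definition zpdvd (D A : {poly int}) : Prop := exists C : {poly int}, A = C * D.

(* Coprimality in the factorial ring Z[q] (no common factor but +1 and -1),
   not comaximality. *)
Definition zpcoprime (P A : {poly int}) : Prop :=
  forall D : {poly int}, zpdvd D P -> zpdvd D A -> D \is a GRing.unit.

Definition zqmod0 (P : {poly int}) (F : Zq) : Prop :=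
  exists A1 A2 : {poly int},
    [/\ A2 != 0, F = tofrac A1 / tofrac A2, zpdvd P A1 & zpcoprime P A2].

Definition zqcong (P : {poly int}) (F G : Zq) : Prop := zqmod0 P (F - G).

Definition qpoch (K : fieldType) (a q : K) (k : nat) : K :=
  \prod_(0 <= i < k) (1 - a * q ^+ i).

Definition lcd (r1 r2 : rat) : nat := lcmn `|denq r1| `|denq r2|.

(* The integer d * r, when the denominator of r divides d. *)
Definition scaled (d : nat) (r : rat) : int := numq (d%:R * r).

(* The base q is an argument in an arbitrary field, so that H(N; q) and
   H(N; q^(n^2)) are the values at qvar and at qvar ^+ (n ^ 2). *)
Definition H (K : fieldType) (r1 r2 : rat) (N : nat) (q : K) : K :=
  let d := lcd r1 r2 in
  \sum_(0 <= k < N)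
    (qpoch (q ^ scaled d r1) (q ^+ d) k
     * qpoch (q ^ scaled d (1 - r1)) (q ^+ d) k
     * qpoch (q ^ scaled d r2) (q ^+ d) k
     * qpoch (q ^ scaled d (1 - r2)) (q ^+ d) k)
    / qpoch (q ^+ d) (q ^+ d) k ^+ 4
    * q ^+ (d * k).

Definition admissible (r1 r2 : rat) : Prop :=
  (r1 \in [:: 1 / 2; 1 / 3; 1 / 4; 1 / 6]
   /\ r2 \in [:: 1 / 2; 1 / 3; 1 / 4; 1 / 6])
  \/ (r1, r2) \in [:: (1 / 5, 2 / 5); (1 / 8, 3 / 8);
                      (1 / 10, 3 / 10); (1 / 12, 5 / 12)].

(* Main.v *)
From HB Require Import structures.
Require Import Defs.
From mathcomp Require Import all_boot all_order all_algebra all_field.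
From mathcomp Require Import ring lra zify.

(* Fix a primitive n-th root of unity z, and work modulo powers of eps = Phi_n(q)
   in the local ring of rational functions regular at z.  Everything reduces to
     sum_(k < n) c(n l + k) = c'(l) * sum_(k < n) c(k)   modulo eps^3,
   where c and c' are the summands of H(N; q) and H(N; q^(n^2)), together with
   H(n; q) being a unit.
   Put p = q^d; each numerator parameter has the form a p^(-m) or p^(m+1) / a with
   a a power of q^n and m < n.  Then c(n l + k) / c'(l) is, up to factors
   independent of l modulo eps^3, the k-th summand of a rational function f(s) of
   s = p^(- n l), so it is enough that f be constant modulo eps^3 near s = 1.  By
   the residue theorem f takes the same value at s = a1 and s = a2; hence
   f(s) - f(a1) is divisible by (s - a1)(s - a2), of order eps^2, and a third
   factor eps comes from f being constant at q = z, which is a computation with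
   sums over n-th roots of unity.
   Finally, for a suitable z the summands of H(n; z) are nonnegative reals, the
   first one being 1: they are products of sines of multiples of pi / n. *)

Set Implicit Arguments.
Unset Strict Implicit.
Unset Printing Implicit Defensive.

Import Order.TTheory GRing.Theory Num.Theory.
Local Open Scope ring_scope.

(** * Places and germs of rational functions *)

(** The form a p^(-m) and the base q^(n^2) have one origin. Each of the exponents s among s1, d -
    s1, s2, d - s2 is congruent modulo d to n x, with x again one of them; this stability under
    units modulo d is what the admissible pairs share. Writing s = n x - d m gives q^s = a p^(-m)
    with a = q^(n x), and a^n = (q^(n^2))^x is a parameter of c'. Independence of l modulo eps^3 is
    not exact, and holds only for the two parameters a p^(-m), p^(m+1) / a taken together. The
    complete blocks of n factors enter through a function Theta with Theta(t a) Theta(t / a) =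
    Theta(t)^2 modulo eps^3, by the same two-point argument as for f. The incomplete block leaves
    weights 1 + O(eps^2) depending on k in front of the summands of f; they are harmless because
    each single summand changes with l only by O(eps). Divisions are controlled by positivity twice:
    for H(n; q) at z, and for H(N; q^(n^2)), whose base reduces to 1. *)

Record place (K C : fieldType) (hv : K -> C -> Prop) (eps : K) : Prop := Place {
  hv0 : hv 0 0;
  hv1 : hv 1 1;
  hvD : forall x y a b, hv x a -> hv y b -> hv (x + y) (a + b);
  hvN : forall x a, hv x a -> hv (- x) (- a);
  hvM : forall x y a b, hv x a -> hv y b -> hv (x * y) (a * b);
  hvV : forall x a, hv x a -> a != 0 -> hv x^-1 a^-1;
  hv_uniq : forall x a b, hv x a -> hv x b -> a = b;
  hv_eps : hv eps 0;
  eps_neq0 : eps != 0;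
  hv_eps_div : forall x, hv x 0 -> exists y a, hv y a /\ x = eps * y }.

Section Place.
Variables (K C : fieldType) (hv : K -> C -> Prop) (eps : K).
Hypothesis pl : place hv eps.

(** [hv x a] says that [x] lies in the local ring and has residue [a]; it is a relation because the
    residue is only partially defined. By [hv_eps_div] the elements of residue 0 are the multiples
    of [eps], so [eqmod r] is congruence modulo the r-th power of the maximal ideal. *)
Definition regular x := exists a, hv x a.
Definition eqmod r x y := exists z, regular z /\ x - y = eps ^+ r * z.

Lemma hvB x y a b : hv x a -> hv y b -> hv (x - y) (a - b).
Proof. by move=> hx hy; apply: (hvD pl) => //; apply: (hvN pl). Qed.

Lemma hvF x y a b : hv x a -> hv y b -> b != 0 -> hv (x / y) (a / b).
Proof. by move=> hx hy nb; apply: (hvM pl) => //; apply: (hvV pl). Qed.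

Lemma hvX x a k : hv x a -> hv (x ^+ k) (a ^+ k).
Proof.
move=> hx; elim: k => [|k IH]; first by rewrite !expr0; apply: (hv1 pl).
by rewrite !exprS; apply: (hvM pl).
Qed.

Lemma hv_sum (I : Type) (r : seq I) (Pr : pred I) (F : I -> K) (G : I -> C) :
  (forall i, Pr i -> hv (F i) (G i)) ->
  hv (\sum_(i <- r | Pr i) F i) (\sum_(i <- r | Pr i) G i).
Proof.
by move=> h; apply: (big_rec2 hv); [apply: (hv0 pl)|move=> i x y Pi; apply: (hvD pl); apply: h].
Qed.

Lemma hv_prod (I : Type) (r : seq I) (Pr : pred I) (F : I -> K) (G : I -> C) :
  (forall i, Pr i -> hv (F i) (G i)) ->
  hv (\prod_(i <- r | Pr i) F i) (\prod_(i <- r | Pr i) G i).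
Proof.
by move=> h; apply: (big_rec2 hv); [apply: (hv1 pl)|move=> i x y Pi; apply: (hvM pl); apply: h].
Qed.

Lemma hv_neq0 x a : hv x a -> a != 0 -> x != 0.
Proof.
move=> hx; apply: contra_neq => x0; rewrite x0 in hx.
by apply: (hv_uniq pl) hx (hv0 pl).
Qed.

Lemma hv1n x k : hv x 1 -> hv (x ^+ k) 1.
Proof. by move/(hvX k); rewrite expr1n. Qed.

Lemma hv1V x : hv x 1 -> hv x^-1 1.
Proof. by move=> /(hvV pl); rewrite invr1; apply; rewrite oner_neq0. Qed.

Lemma hv1M x y : hv x 1 -> hv y 1 -> hv (x * y) 1.
Proof. by move=> hx /(hvM pl hx); rewrite mulr1. Qed.

Lemma regular0 : regular 0. Proof. by exists 0; apply: (hv0 pl). Qed.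
Lemma regularD x y : regular x -> regular y -> regular (x + y).
Proof. by move=> [a ha] [b hb]; exists (a + b); apply: (hvD pl). Qed.
Lemma regularN x : regular x -> regular (- x).
Proof. by move=> [a ha]; exists (- a); apply: (hvN pl). Qed.
Lemma regularM x y : regular x -> regular y -> regular (x * y).
Proof. by move=> [a ha] [b hb]; exists (a * b); apply: (hvM pl). Qed.
Lemma regularX x k : regular x -> regular (x ^+ k).
Proof. by move=> [a ha]; exists (a ^+ k); apply: hvX. Qed.
Lemma regular_eps : regular eps. Proof. by exists 0; apply: (hv_eps pl). Qed.

Lemma regular_prod (I : Type) (r : seq I) (Pr : pred I) (F : I -> K) :
  (forall i, Pr i -> regular (F i)) -> regular (\prod_(i <- r | Pr i) F i).
Proof.
move=> h; apply: (big_ind regular) => //; last exact: regularM.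
by exists 1; apply: (hv1 pl).
Qed.

Lemma eqmod_refl r x : eqmod r x x.
Proof. by exists 0; rewrite subrr mulr0; split=> //; apply: regular0. Qed.

Lemma eqmod_sym r x y : eqmod r x y -> eqmod r y x.
Proof.
by move=> [z [hz e]]; exists (- z); rewrite mulrN -e opprB; split=> //; apply: regularN.
Qed.

Lemma eqmod_trans r y x z : eqmod r x y -> eqmod r y z -> eqmod r x z.
Proof.
move=> [a [ha ea]] [b [hb eb]]; exists (a + b); split; first exact: regularD.
by rewrite mulrDr -ea -eb; ring.
Qed.

Lemma eqmodD r x y x' y' : eqmod r x x' -> eqmod r y y' -> eqmod r (x + y) (x' + y').
Proof.
move=> [a [ha ea]] [b [hb eb]]; exists (a + b); split; first exact: regularD.
by rewrite mulrDr -ea -eb; ring.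
Qed.

Lemma eqmodM r x y x' y' : regular x' -> regular y -> eqmod r x x' -> eqmod r y y' ->
  eqmod r (x * y) (x' * y').
Proof.
move=> hx hy [a [ha ea]] [b [hb eb]]; exists (a * y + x' * b).
split; first by apply: regularD; apply: regularM.
have -> : x * y - x' * y' = (x - x') * y + x' * (y - y') by ring.
by rewrite ea eb; ring.
Qed.

Lemma eqmodMl r x y y' : regular x -> eqmod r y y' -> eqmod r (x * y) (x * y').
Proof.
move=> hx [b [hb eb]]; exists (x * b); split; first exact: regularM.
by rewrite -mulrBr eb mulrCA.
Qed.

Lemma eqmod_regular r x y : eqmod r x y -> regular y -> regular x.
Proof.
move=> [a [ha ea]] hy; have -> : x = y + eps ^+ r * a by rewrite -ea; ring.
by apply: regularD => //; apply: regularM => //; apply: regularX; apply: regular_eps.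
Qed.

Lemma eqmod_hv r x y a : eqmod r.+1 x y -> hv y a -> hv x a.
Proof.
move=> [z [[c hz] e]] hy; have -> : x = y + eps * (eps ^+ r * z).
  by rewrite mulrA -exprS -e; ring.
rewrite -[a]addr0 -(mul0r (0 ^+ r * c)).
apply: (hvD pl) => //; apply: (hvM pl); first exact: (hv_eps pl).
by apply: (hvM pl) => //; apply: hvX; apply: (hv_eps pl).
Qed.

Lemma eqmodV r x y a : hv x a -> hv y a -> a != 0 -> eqmod r x y -> eqmod r x^-1 y^-1.
Proof.
move=> hx hy na [b [hb eb]]; exists (- (b * (x^-1 * y^-1))); split.
  apply: regularN; apply: regularM => //.
  by apply: regularM; exists a^-1; apply: (hvV pl).
have nx := hv_neq0 hx na; have ny := hv_neq0 hy na.
have -> : x^-1 - y^-1 = - ((x - y) * (x^-1 * y^-1)) by field; rewrite nx ny.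
by rewrite eb; ring.
Qed.

Lemma eqmod1 x y a : hv x a -> hv y a -> eqmod 1 x y.
Proof.
move=> hx hy; have := hvB hx hy; rewrite subrr => /(hv_eps_div pl) [z [b [hz e]]].
by exists z; split; [exists b | rewrite expr1].
Qed.

Lemma eqmod0M r k x y z : eqmod r x 0 -> eqmod k y z -> eqmod (r + k) (x * y) (x * z).
Proof.
rewrite /eqmod subr0 => -[a [ha ->]] [b [hb eb]]; exists (a * b); split; first exact: regularM.
by rewrite -mulrBr eb exprD; ring.
Qed.

Lemma eqmod_sum r (I : Type) (s : seq I) (Pr : pred I) (F G : I -> K) :
  (forall i, Pr i -> eqmod r (F i) (G i)) ->
  eqmod r (\sum_(i <- s | Pr i) F i) (\sum_(i <- s | Pr i) G i).
Proof.
move=> h; apply: (big_rec2 (eqmod r)); first exact: eqmod_refl.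
by move=> i x y Pi; apply: eqmodD; apply: h.
Qed.

Lemma eqmod_prod r (I : Type) (s : seq I) (Pr : pred I) (F G : I -> K) :
  (forall i, Pr i -> regular (G i) /\ eqmod r (F i) (G i)) ->
  eqmod r (\prod_(i <- s | Pr i) F i) (\prod_(i <- s | Pr i) G i).
Proof.
move=> h.
suff [] : regular (\prod_(i <- s | Pr i) G i) /\
  eqmod r (\prod_(i <- s | Pr i) F i) (\prod_(i <- s | Pr i) G i) by [].
apply: (big_rec2 (fun x y => regular y /\ eqmod r x y)).
  by split; [exists 1; apply: (hv1 pl) | apply: eqmod_refl].
move=> i x y Pi [hy hx]; have [hG hF] := h i Pi; split; first exact: regularM.
by apply: eqmodM => //; apply: eqmod_regular hx _.
Qed.

(** * Polynomials over the local ring and their reductions *)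

Definition regular_poly (P : {poly K}) := forall i, regular P`_i.
Definition value_poly (P : {poly K}) (Pb : {poly C}) := forall i, hv P`_i Pb`_i.

Lemma value_poly_regular P Pb : value_poly P Pb -> regular_poly P.
Proof. by move=> h i; exists Pb`_i. Qed.

Lemma value_polyC x a : hv x a -> value_poly x%:P a%:P.
Proof. by move=> h i; rewrite !coefC; case: ifP => _ //; apply: (hv0 pl). Qed.

Lemma value_polyX : value_poly 'X 'X.
Proof.
by move=> i; rewrite !coefX; case: (i == 1%N); [apply: (hv1 pl) | apply: (hv0 pl)].
Qed.

Lemma value_polyD P Q Pb Qb : value_poly P Pb -> value_poly Q Qb -> value_poly (P + Q) (Pb + Qb).
Proof. by move=> hP hQ i; rewrite !coefD; apply: (hvD pl). Qed.

Lemma value_polyB P Q Pb Qb : value_poly P Pb -> value_poly Q Qb -> value_poly (P - Q) (Pb - Qb).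
Proof. by move=> hP hQ i; rewrite !coefB; apply: hvB. Qed.

Lemma value_polyM P Q Pb Qb : value_poly P Pb -> value_poly Q Qb -> value_poly (P * Q) (Pb * Qb).
Proof.
by move=> hP hQ i; rewrite !coefM; apply: hv_sum => j _; apply: (hvM pl).
Qed.

Lemma value_poly_horner P Pb s t : value_poly P Pb -> hv s t -> hv P.[s] Pb.[t].
Proof.
move=> hP hs.
(* The leading coefficient may reduce to 0, so the two sizes can differ. *)
pose N := maxn (size P) (size Pb).
have -> : P.[s] = \sum_(i < N) P`_i * s ^+ i.
  by apply: horner_coef_wide; rewrite leq_maxl.
have -> : Pb.[t] = \sum_(i < N) Pb`_i * t ^+ i.
  by apply: horner_coef_wide; rewrite leq_maxr.
by apply: hv_sum => i _; apply: (hvM pl) => //; apply: hvX.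
Qed.

(** Division by the monic ['X - a%:P] needs no division of coefficients, so the quotient stays over
    the local ring. *)
Lemma regular_poly_factor P a : regular_poly P -> regular a ->
  exists2 G, regular_poly G & P = ('X - a%:P) * G + P.[a]%:P.
Proof.
move=> + ha; elim/poly_ind: P => [_ | P c IH hP].
  exists 0; first by move=> i; rewrite coef0; apply: regular0.
  by rewrite horner0 mulr0 add0r.
have hP' : regular_poly P by move=> i; have := hP i.+1; rewrite coefD coefMX coefC addr0.
have hc : regular c by have := hP 0%N; rewrite coefD coefMX coefC add0r.
have [G hG eG] := IH hP'.
have hPa : regular P.[a].
  rewrite horner_coef; apply: (big_ind regular); [exact: regular0|exact: regularD|].
  by move=> i _; apply: regularM => //; apply: regularX.
exists (G * 'X + P.[a]%:P).
  move=> i; rewrite coefD coefMX coefC; case: i => [|i] /=.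
    by rewrite add0r.
  by rewrite addr0.
by rewrite !hornerE polyCD polyCM {1}eG; ring.
Qed.

Lemma regular_poly_horner P a : regular_poly P -> regular a -> regular P.[a].
Proof.
move=> hP ha; rewrite horner_coef; apply: (big_ind regular); [exact: regular0|exact: regularD|].
by move=> i _; apply: regularM => //; apply: regularX.
Qed.

Lemma value_poly0_div P : value_poly P 0 -> exists2 P1, regular_poly P1 & P = eps *: P1.
Proof.
move=> hP; exists (eps^-1 *: P); last by rewrite scalerA divff ?scale1r // (eps_neq0 pl).
move=> i; rewrite coefZ; have := hP i; rewrite coef0 => /(hv_eps_div pl) [y [a [hy ->]]].
by rewrite mulKf ?(eps_neq0 pl) //; exists a.
Qed.

(* [fb] is the reduction of the rational function [f]; only points where the
   denominator survives are constrained. *)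
Definition germ (f : K -> K) (fb : C -> C) :=
  exists P E Pb Eb, [/\ value_poly P Pb, value_poly E Eb, Eb.[1] != 0,
    (forall s, E.[s] != 0 -> f s = P.[s] / E.[s]) &
    (forall t, Eb.[t] != 0 -> fb t = Pb.[t] / Eb.[t])].

Lemma germ_cst x a : hv x a -> germ (fun=> x) (fun=> a).
Proof.
move=> h; exists x%:P, 1, a%:P, 1; rewrite !hornerE oner_neq0; split=> //.
- exact: value_polyC.
- by rewrite -!polyC1; apply: value_polyC; apply: (hv1 pl).
- by move=> s _; rewrite !hornerE divr1.
- by move=> s _; rewrite !hornerE divr1.
Qed.

Lemma germ_id : germ id id.
Proof.
exists 'X, 1, 'X, 1; rewrite !hornerE oner_neq0; split=> //.
- exact: value_polyX.
- by rewrite -!polyC1; apply: value_polyC; apply: (hv1 pl).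
- by move=> s _; rewrite !hornerE divr1.
- by move=> s _; rewrite !hornerE divr1.
Qed.

Lemma germD f g fb gb : germ f fb -> germ g gb ->
  germ (fun s => f s + g s) (fun t => fb t + gb t).
Proof.
move=> [P [E [Pb [Eb [hP hE nE ef efb]]]]] [Q [F [Qb [Fb [hQ hF nF eg egb]]]]].
exists (P * F + Q * E), (E * F), (Pb * Fb + Qb * Eb), (Eb * Fb); split.
- by apply: value_polyD; apply: value_polyM.
- exact: value_polyM.
- by rewrite hornerM mulf_neq0.
- move=> s; rewrite !hornerE mulf_eq0 negb_or => /andP[n1 n2].
  by rewrite ef // eg //; field; rewrite n1 n2.
- move=> s; rewrite !hornerE mulf_eq0 negb_or => /andP[n1 n2].
  by rewrite efb // egb //; field; rewrite n1 n2.
Qed.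

Lemma germM f g fb gb : germ f fb -> germ g gb ->
  germ (fun s => f s * g s) (fun t => fb t * gb t).
Proof.
move=> [P [E [Pb [Eb [hP hE nE ef efb]]]]] [Q [F [Qb [Fb [hQ hF nF eg egb]]]]].
exists (P * Q), (E * F), (Pb * Qb), (Eb * Fb); split.
- exact: value_polyM.
- exact: value_polyM.
- by rewrite hornerM mulf_neq0.
- move=> s; rewrite !hornerE mulf_eq0 negb_or => /andP[n1 n2].
  by rewrite ef // eg //; field; rewrite n1 n2.
- move=> s; rewrite !hornerE mulf_eq0 negb_or => /andP[n1 n2].
  by rewrite efb // egb //; field; rewrite n1 n2.
Qed.

Lemma germV f fb : germ f fb -> fb 1 != 0 ->
  germ (fun s => (f s)^-1) (fun t => (fb t)^-1).
Proof.
move=> [P [E [Pb [Eb [hP hE nE ef efb]]]]]; rewrite efb //.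
rewrite mulf_eq0 negb_or => /andP[nP _].
exists (E * E), (P * E), (Eb * Eb), (Pb * Eb); split.
- exact: value_polyM.
- exact: value_polyM.
- by rewrite hornerM mulf_neq0.
- move=> s; rewrite !hornerE mulf_eq0 negb_or => /andP[n1 n2].
  by rewrite ef //; field; rewrite n1 n2.
- move=> s; rewrite !hornerE mulf_eq0 negb_or => /andP[n1 n2].
  by rewrite efb //; field; rewrite n1 n2.
Qed.

Lemma germ_ext f g fb gb : germ f fb -> f =1 g -> fb =1 gb -> germ g gb.
Proof.
move=> [P [E [Pb [Eb [hP hE nE ef efb]]]]] efg efgb.
exists P, E, Pb, Eb; split=> // [s | t] n; first by rewrite -efg ef.
by rewrite -efgb efb.
Qed.

Lemma germ_sum (I : Type) (r : seq I) (Pr : pred I) (F : I -> K -> K) (G : I -> C -> C) :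
  (forall i, Pr i -> germ (F i) (G i)) ->
  germ (fun s => \sum_(i <- r | Pr i) F i s) (fun t => \sum_(i <- r | Pr i) G i t).
Proof.
move=> h; elim: r => [|i r IH].
  by apply: (germ_ext (germ_cst (hv0 pl))) => s; rewrite big_nil.
case Pi: (Pr i); last by apply: (germ_ext IH) => s; rewrite big_cons Pi.
by apply: (germ_ext (germD (h i Pi) IH)) => s; rewrite big_cons Pi.
Qed.

Lemma germ_prod (I : Type) (r : seq I) (Pr : pred I) (F : I -> K -> K) (G : I -> C -> C) :
  (forall i, Pr i -> germ (F i) (G i)) ->
  germ (fun s => \prod_(i <- r | Pr i) F i s) (fun t => \prod_(i <- r | Pr i) G i t).
Proof.
move=> h; elim: r => [|i r IH].
  by apply: (germ_ext (germ_cst (hv1 pl))) => s; rewrite big_nil.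
case Pi: (Pr i); last by apply: (germ_ext IH) => s; rewrite big_cons Pi.
by apply: (germ_ext (germM (h i Pi) IH)) => s; rewrite big_cons Pi.
Qed.

Lemma germX f fb k : germ f fb -> germ (fun s => f s ^+ k) (fun t => fb t ^+ k).
Proof.
move=> h; elim: k => [|k IH].
  by apply: (germ_ext (germ_cst (hv1 pl))) => s; rewrite expr0.
by apply: (germ_ext (germM h IH)) => s; rewrite exprS.
Qed.

Lemma germ_hv f fb s : germ f fb -> hv s 1 -> hv (f s) (fb 1).
Proof.
move=> [P [E [Pb [Eb [hP hE nE ef efb]]]]] hs; rewrite efb //.
have hEs := value_poly_horner hE hs.
by rewrite ef ?(hv_neq0 hEs) //; apply: hvF => //; apply: value_poly_horner.
Qed.

Lemma germ_eqmod r f fb s s' : germ f fb -> hv s 1 -> hv s' 1 -> eqmod r s s' ->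
  eqmod r (f s) (f s').
Proof.
move=> [P [E [Pb [Eb [hP hE nE ef efb]]]]] hs hs' [z [hz e]].
have rs : regular s by exists 1. have rs' : regular s' by exists 1.
have pcg F : regular_poly F -> eqmod r F.[s] F.[s'].
  move=> hF; have [G hG eG] := regular_poly_factor hF rs'.
  exists (z * G.[s]); split; first by apply: regularM => //; apply: regular_poly_horner.
  by rewrite {1}eG !hornerE addrK e.
have hEs := value_poly_horner hE hs; have hEs' := value_poly_horner hE hs'.
have hPs := value_poly_horner hP hs; have hPs' := value_poly_horner hP hs'.
rewrite (ef _ (hv_neq0 hEs nE)) (ef _ (hv_neq0 hEs' nE)).
apply: eqmodM; [by exists Pb.[1]| by exists (Eb.[1])^-1; apply: (hvV pl) | |].
  exact/pcg/(value_poly_regular hP).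
by apply: (eqmodV hEs hEs') => //; apply/pcg/(value_poly_regular hE).
Qed.

End Place.

Lemma poly_eq0_num (C : numFieldType) (P : {poly C}) : (forall t, P.[t] = 0) -> P = 0.
Proof.
move=> h; apply: (@roots_geq_poly_eq0 _ P [seq i%:R | i <- iota 0 (size P)]).
- by apply/allP => x _; rewrite /root h.
- by rewrite map_inj_uniq ?iota_uniq // => i j /eqP; rewrite eqr_nat => /eqP.
- by rewrite size_map size_iota.
Qed.

(* If [f] takes equal values at [a1] and [a2], then [f s - f a1] is divisible by
   [(s - a1)(s - a2)]; constancy of the reduction contributes one more [eps]. *)
Lemma germ_two_points (K : fieldType) (C : numFieldType) (hv : K -> C -> Prop) eps
    (f : K -> K) (fb : C -> C) (c : C) n a1 a2 s :
  place hv eps -> germ hv f fb -> (0 < n)%N ->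
  (forall t, t != 0 -> t ^+ n != 1 -> fb t = c) ->
  hv a1 1 -> hv a2 1 -> a1 != a2 -> f a1 = f a2 ->
  hv s 1 -> eqmod hv eps 3 (f s) (f a1).
Proof.
move=> pl [P [E [Pb [Eb [hP hE nE ef efb]]]]] n0 fbc h1 h2 n12 f12 hs.
(* The value [c] is known only away from the zeros of [Eb], from 0 and from the n-th roots of unity;
   multiplying by a polynomial that vanishes at all these exceptions gives an identity valid at
   every point. *)
have eP : Pb = c *: Eb.
  have nX : ('X : {poly C}) != 0 by rewrite -size_poly_eq0 size_polyX.
  have nXn : ('X^n - 1 : {poly C}) != 0 by rewrite -size_poly_eq0 size_XnsubC.
  have nEb : Eb != 0 by apply: contraNneq nE => ->; rewrite horner0.
  have : (Pb - c *: Eb) * (Eb * ('X * ('X^n - 1))) = 0.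
    apply: poly_eq0_num => t; rewrite !hornerM !hornerD !hornerN hornerZ hornerX hornerXn hornerC.
    case: (eqVneq (Eb.[t]) 0) => [->|nt]; first by rewrite !(mul0r, mulr0).
    case: (eqVneq t 0) => [->|t0]; first by rewrite !(mul0r, mulr0).
    case: (eqVneq (t ^+ n) 1) => [->|tn]; first by rewrite subrr !mulr0.
    have := fbc t t0 tn; rewrite efb // => e.
    have -> : Pb.[t] = c * Eb.[t] by rewrite -e; field.
    by rewrite subrr mul0r.
  move/eqP; rewrite !mulf_eq0 (negPf nX) (negPf nXn) (negPf nEb) !orbF subr_eq0.
  by move/eqP.
have hE1 := value_poly_horner pl hE h1; have hE2 := value_poly_horner pl hE h2.
have hP1 := value_poly_horner pl hP h1; have hEs := value_poly_horner pl hE hs.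
have n1 := hv_neq0 pl hE1 nE; have n2 := hv_neq0 pl hE2 nE.
have ns := hv_neq0 pl hEs nE.
(* The numerator of [f s - f a1]. It reduces to 0 because [Pb] is proportional to [Eb], whence a
   factor [eps]; the cofactor [D1] vanishes at [a1] and [a2], whence two more. *)
pose D := E.[a1] *: P - P.[a1] *: E.
have hD : value_poly hv D 0.
  have -> : 0 = Eb.[1]%:P * Pb - Pb.[1]%:P * Eb.
    by rewrite eP !(hornerD, hornerN, hornerZ, hornerM, hornerX, hornerC) -!mul_polyC !polyCM;
      ring.
  rewrite /D -!mul_polyC.
  by apply: (value_polyB pl); apply: (value_polyM pl) => //; apply: (value_polyC pl).
have [D1 rD1 eD] := value_poly0_div pl hD.
have ne := eps_neq0 pl.
have r1 : regular hv a1 by exists 1. have r2 : regular hv a2 by exists 1.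
have D11 : D1.[a1] = 0.
  have : D.[a1] = 0 by rewrite /D !(hornerD, hornerN, hornerZ, hornerM, hornerX, hornerC); ring.
  by rewrite eD hornerZ => /eqP; rewrite mulf_eq0 (negPf ne) => /eqP.
have D12 : D1.[a2] = 0.
  have : D.[a2] = 0.
    rewrite /D !(hornerD, hornerN, hornerZ, hornerM, hornerX, hornerC); move: f12;
      rewrite !ef // => /eqP.
    by rewrite eqr_div // => /eqP e; rewrite [_ * E.[a2]]e; ring.
  by rewrite eD hornerZ => /eqP; rewrite mulf_eq0 (negPf ne) => /eqP.
have [G rG eG] := regular_poly_factor pl rD1 r1.
rewrite D11 polyC0 addr0 in eG.
have G2 : G.[a2] = 0.
  move: D12; rewrite eG !(hornerD, hornerN, hornerZ, hornerM, hornerX, hornerC) => /eqP;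
    rewrite mulf_eq0 subr_eq0 eq_sym (negPf n12).
  by move/eqP.
have [G' rG' eG'] := regular_poly_factor pl rG r2.
rewrite G2 polyC0 addr0 in eG'.
have [z1 [rz1 ez1]] := eqmod1 pl hs h1.
have [z2 [rz2 ez2]] := eqmod1 pl hs h2.
have rs : regular hv s by exists 1.
exists (z1 * z2 * G'.[s] * ((E.[s])^-1 * (E.[a1])^-1)); split.
  apply: (regularM pl); last by apply: (regularM pl); exists (Eb.[1]^-1); apply: (hvV pl).
  by apply: (regularM pl); [apply: (regularM pl) | apply: (regular_poly_horner pl)].
rewrite !ef //.
have -> : P.[s] / E.[s] - P.[a1] / E.[a1] = D.[s] * ((E.[s])^-1 * (E.[a1])^-1).
  by rewrite /D !(hornerD, hornerN, hornerZ, hornerM, hornerX, hornerC); field; rewrite n1 ns.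
by rewrite eD eG eG' !(hornerD, hornerN, hornerZ, hornerM, hornerX, hornerC) ez1 ez2; ring.
Qed.

(* The sum of the residues of [P(t) / prod_i (1 - t / x_i)], up to sign. *)
Lemma residue_sum (K : fieldType) (I : finType) (x : I -> K) (P : {poly K}) :
  injective x -> (forall i, x i != 0) -> (size P < #|I|)%N ->
  \sum_i x i * P.[x i] / \prod_(j | j != i) (1 - x i / x j) = 0.
Proof.
move=> xi x0 sP.
pose L i := \prod_(j | j != i) ('X - (x j)%:P).
have Lii i : (L i).[x i] = \prod_(j | j != i) (x i - x j).
  by rewrite horner_prod; apply: eq_bigr => j _;
    rewrite !(hornerD, hornerN, hornerZ, hornerM, hornerX, hornerC).
have nLii i : (L i).[x i] != 0.
  rewrite Lii; apply/prodf_neq0 => j ji; rewrite subr_eq0 (inj_eq xi).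
  by rewrite eq_sym.
have Lij i j : j != i -> (L i).[x j] = 0.
  move=> ji; rewrite horner_prod (bigD1 j) //= !(hornerD, hornerN, hornerZ, hornerM, hornerX,
    hornerC) subrr mul0r //.
have mL i : L i \is monic by apply: monic_prod_XsubC.
have sL i : size (L i) = #|I|.
  rewrite /L -big_filter size_prod_XsubC size_filter -sum1_count sum1dep_card.
  by rewrite [RHS](cardD1 i) add1n; congr S; apply: eq_card => j; rewrite !inE andbT.
pose c i := P.[x i] / (L i).[x i].
(* Lagrange interpolation: both sides have size at most [#|I|] and agree at the [#|I|] nodes. *)
have eP : \sum_i c i *: L i = P.
  apply/eqP; rewrite -subr_eq0; apply/eqP.
  apply: (@roots_geq_poly_eq0 _ _ [seq x i | i <- enum I]).
  - apply/allP => _ /mapP [i _ ->]; rewrite /root !(hornerD, hornerN, hornerZ, hornerM,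
    hornerX, hornerC) horner_sum.
    rewrite (bigD1 i) //= big1 => [|j ji]; last by rewrite hornerZ Lij ?mulr0 // eq_sym.
    by rewrite hornerZ /c divfK // addr0 subrr.
  - by rewrite map_inj_uniq ?enum_uniq.
  - rewrite size_map -cardE (leq_trans (size_polyD _ _)) // size_polyN geq_max.
    rewrite (ltnW sP) andbT; apply: (leq_trans (size_sum _ _ _)).
    by apply/bigmax_leqP => i _; rewrite (leq_trans (size_scale_leq _ _)) // sL.
(* Compare the coefficients of index [#|I|.-1]: each [L i] is monic of that degree, and [P] is too
   short to have one. *)
have sc : \sum_i c i = 0.
  have : P`_(#|I|.-1) = 0 by rewrite nth_default //; case: #|I| sP.
  rewrite -eP coef_sum => e; rewrite -[RHS]e; apply: eq_bigr => i _.
  by rewrite coefZ -(sL i) -lead_coefE (monicP (mL i)) mulr1.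
have e i : x i * P.[x i] / \prod_(j | j != i) (1 - x i / x j) = - \prod_j (- x j) * c i.
  rewrite /c Lii.
  have -> : \prod_(j | j != i) (x i - x j) =
      \prod_(j | j != i) (- x j) * \prod_(j | j != i) (1 - x i / x j).
    by rewrite -big_split; apply: eq_bigr => j _ /=; field.
  rewrite [\prod_j (- x j)](bigD1 i) //=.
  have n1 : \prod_(j | j != i) (- x j) != 0.
    by apply/prodf_neq0 => j _; rewrite oppr_eq0.
  have n2 : \prod_(j | j != i) (1 - x i / x j) != 0.
    apply/prodf_neq0 => j ji; rewrite subr_eq0; apply: contraNneq ji => e.
    by apply/eqP/xi; rewrite -[LHS]mul1r e divfK.
  move: n1 n2.
  move: (\prod_(j | j != i) - x j) (\prod_(j | j != i) (1 - x i / x j)) => a b na nb.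
  by field; rewrite na nb.
under eq_bigr => i _ do rewrite e.
by rewrite -mulr_sumr sc mulr0.
Qed.

(** * The summand as a rational function of s *)

Section Blocks.
Variable F : fieldType.
Implicit Types (a p s t : F) (m k n : nat).

Definition geom n t := \sum_(i < n) t ^+ i.
(** At t = p^(-N), the quotient of [num_prod] by [den_prod] is what [m] contributes to (a p^(-m);
    p)_N (p^(m+1) / a; p)_N as N varies; see [qpoch_pair]. *)
Definition num_prod a p m t := \prod_(j < m) (1 - t * (a / p ^+ j.+1)).
Definition den_prod a p m t := \prod_(j < m.+1) (1 - t * (p ^+ j / a)).

(* [geom n (s / a) * den_part] is [(1 - (s / a) ^+ n) / den_prod a p m (s / p ^+ k)] with the
   common factor [1 - s / a] cancelled, so that it makes sense at [s = a]. *)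
Definition den_part a p m k s :=
  (if (k <= m)%N then 1 else 1 - s * a^-1) /
  \prod_(j < m.+1 | (j : nat) != k) (1 - s * (p ^+ j / p ^+ k / a)).
Definition block_factor n a p m k s := geom n (s * a^-1) * num_prod a p m (s * (p ^+ k)^-1) *
  den_part a p m k s.
(** The f(s) of the overview. The powers of p met in the two pairs, in q^(d k) and in c'(l) combine
    to s^(1-n) p^(-k) at s = p^(-n l). *)
Definition block_fun n p a1 m1 a2 m2 s :=
  s * (s ^+ n)^-1 * \sum_(k < n) (p ^+ k)^-1 * (block_factor n a1 p m1 k s * block_factor n a2
    p m2 k s).

Lemma geomE n t : (1 - t) * geom n t = 1 - t ^+ n.
Proof. by rewrite -[LHS]opprK -mulNr opprB -subrX1 opprB. Qed.

Lemma geom1 n : geom n 1 = n%:R.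
Proof.
rewrite /geom; under eq_bigr => i _ do rewrite expr1n.
by rewrite sumr_const card_ord.
Qed.

Lemma den_partE a p m k s : p != 0 -> a != s ->
  den_part a p m k s = (1 - s * a^-1) / den_prod a p m (s * (p ^+ k)^-1).
Proof.
move=> p0 nas.
have npk j : p ^+ j != 0 by rewrite expf_neq0.
have ns : 1 - s * a^-1 != 0.
  rewrite subr_eq0; apply: contraNneq nas => e; apply/eqP.
  have a0 : a != 0 by apply: contra_eq_neq e => ->; rewrite invr0 mulr0 oner_neq0.
  by rewrite -[LHS]mul1r e divfK.
have eq_f j : 1 - s * (p ^+ k)^-1 * (p ^+ j / a) = 1 - s * (p ^+ j / p ^+ k / a).
  by rewrite -!mulrA; congr (1 - _ * _); rewrite mulrCA.
rewrite /den_part /den_prod; under [in RHS]eq_bigr => j _ do rewrite eq_f.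
case: leqP => [le_km | lt_mk].
  rewrite [in RHS](bigD1 (Ordinal (n := m.+1) le_km)) //= divff // !mul1r invfM mulrA.
  by rewrite divff // mul1r; congr (_^-1); apply: eq_bigl => j; rewrite -val_eqE.
by congr (_ / _); apply: eq_bigl => j; rewrite neq_ltn (leq_trans (ltn_ord j)).
Qed.

Lemma den_part_at a p m k : p != 0 -> a != 0 ->
  den_part a p m k a = if (k <= m)%N then
    (\prod_(j < m.+1 | (j : nat) != k) (1 - p ^+ j / p ^+ k))^-1 else 0.
Proof.
move=> p0 a0; rewrite /den_part divff // subrr; case: ifP; rewrite ?mul0r // mul1r => _.
congr _^-1; apply: eq_bigr => j _; congr (1 - _); field.
by rewrite a0 !expf_neq0.
Qed.

(** At s = a1 the terms with k > m1 carry the vanishing factor 1 - s / a1, and [geom n 1] is n. What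
    remains is a sum of residues at the points a1 / p^k, times a factor that changes sign when a1
    and a2 are exchanged. *)
Lemma block_fun_at n p a1 m1 a2 m2 : p != 0 -> a1 != 0 -> a2 != 0 -> a1 != a2 -> (m1 < n)%N ->
  block_fun n p a1 m1 a2 m2 a1 = n%:R * ((a1 ^+ n)^-1 - (a2 ^+ n)^-1) *
  \sum_(k < m1.+1) (a1 / p ^+ k) * (num_prod a1 p m1 (a1 / p ^+ k) *
    num_prod a2 p m2 (a1 / p ^+ k))
   / (\prod_(j < m1.+1 | j != k) (1 - p ^+ j / p ^+ k) * den_prod a2 p m2 (a1 / p ^+ k)).
Proof.
move=> p0 a10 a20 n12 ltm.
rewrite /block_fun; pose S k := (p ^+ k)^-1 * (block_factor n a1 p m1 k a1 * block_factor n a2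
  p m2 k a1).
rewrite -/(S _) (eq_bigr (fun k : 'I_n => if (k < m1.+1)%N then S k else 0)); last first.
  move=> k _; case: ifP => // km; rewrite /block_factor den_part_at // -ltnS km.
  by rewrite mulr0 mul0r mulr0.
rewrite -big_mkcond -(big_ord_widen _ S) // !mulr_sumr; apply: eq_bigr => k _.
have le_km : (k <= m1)%N by rewrite -ltnS.
rewrite /S /block_factor den_part_at // le_km den_partE // 1?eq_sym // divff // geom1.
have np j : p ^+ j != 0 by rewrite expf_neq0.
have n12' : 1 - a1 * a2^-1 != 0.
  by rewrite subr_eq0; apply: contraNneq n12 => e; rewrite -[a2]mul1r e divfK.
have -> : geom n (a1 * a2^-1) = (1 - a1 ^+ n / a2 ^+ n) / (1 - a1 / a2).
  by rewrite -expr_div_n -geomE mulrAC divff // mul1r.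
rewrite (eq_bigl (fun j : 'I_m1.+1 => j != k)) // invfM.
move: (num_prod a1 _ _ _) (num_prod a2 _ _ _) => x y.
set u := (\prod_(_ < _ | _) _)^-1; set v := (den_prod _ _ _ _)^-1.
have nn1 : a1 ^+ n != 0 by rewrite expf_neq0.
have nn2 : a2 ^+ n != 0 by rewrite expf_neq0.
move: (a1 ^+ n) (a2 ^+ n) (p ^+ k) (np k) nn1 nn2 => b1 b2 pk npk nb1 nb2.
have n21 : a2 - a1 != 0 by rewrite subr_eq0 eq_sym.
by field; rewrite nb1 nb2 npk a20 n21.
Qed.

Lemma block_fun_sym n p a1 m1 a2 m2 s : block_fun n p a1 m1 a2 m2 s = block_fun n p a2 m2 a1 m1 s.
Proof.
rewrite /block_fun; congr (_ * _); apply: eq_bigr => k _.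
by rewrite [block_factor n a1 _ _ _ _ * _]mulrC.
Qed.

(** The points a1 / p^k and a2 / p^k together are m1 + m2 + 2 simple poles, while the numerator has
    degree at most m1 + m2, so all residues add up to 0. The two partial sums are thus opposite, and
    so are the antisymmetric prefactors given by [block_fun_at]. *)
Lemma block_fun_two_values n p a1 m1 a2 m2 : p != 0 -> a1 != 0 -> a2 != 0 ->
  (m1 < n)%N -> (m2 < n)%N -> a1 != a2 ->
  (forall a b i j, a \in [:: a1; a2] -> b \in [:: a1; a2] -> (i < n)%N -> (j < n)%N ->
     i != j -> a / p ^+ i != b / p ^+ j) ->
  block_fun n p a1 m1 a2 m2 a1 = block_fun n p a1 m1 a2 m2 a2.
Proof.
move=> p0 a10 a20 lm1 lm2 n12 hd.
have np j : p ^+ j != 0 by rewrite expf_neq0.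
rewrite block_fun_at // block_fun_sym block_fun_at // 1?eq_sym //.
pose x (i : 'I_m1.+1 + 'I_m2.+1) :=
  match i with inl k => a1 / p ^+ k | inr k => a2 / p ^+ k end.
pose P := \prod_(j < m1) (1 - (a1 / p ^+ j.+1)%:P * 'X) *
          \prod_(j < m2) (1 - (a2 / p ^+ j.+1)%:P * 'X).
have sB b M : (size (\prod_(j < M) (1 - (b / p ^+ j.+1)%:P * 'X))%R <= M.+1)%N.
  elim: M => [|M IH]; first by rewrite big_ord0 size_poly1.
  rewrite big_ord_recr /=; apply: leq_trans (size_polyMleq _ _) _.
  have s2 c : (size (1 - c%:P * 'X : {poly F})%R <= 2)%N.
    rewrite (leq_trans (size_polyD _ _)) // size_polyN geq_max size_poly1 /=.
    by rewrite mul_polyC (leq_trans (size_scale_leq _ _)) // size_polyX.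
  by rewrite -ltnS; case: (_ + _)%N (leq_add IH (s2 (b / p ^+ M.+1))) => [|u] //; rewrite addn2.
have PE t : P.[t] = num_prod a1 p m1 t * num_prod a2 p m2 t.
  rewrite /P hornerM !horner_prod /num_prod; congr (_ * _); apply: eq_bigr => j _;
  by rewrite !(hornerD, hornerN, hornerM, hornerX, hornerC) mulrC.
have xi : injective x.
  have lt1 (i : 'I_m1.+1) : (i < n)%N by apply: leq_trans (ltn_ord i) _.
  have lt2 (i : 'I_m2.+1) : (i < n)%N by apply: leq_trans (ltn_ord i) _.
  have i1 : a1 \in [:: a1; a2] by rewrite !inE eqxx.
  have i2 : a2 \in [:: a1; a2] by rewrite !inE eqxx orbT.
  move=> [i|i] [j|j] /= e.
  - congr inl; apply/val_inj; apply: contra_eq e => ne; exact: hd.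
  - have [ij|ij] := eqVneq (i : nat) j; last first.
      by have := hd _ _ _ _ i1 i2 (lt1 i) (lt2 j) ij; rewrite e eqxx.
    move: e; rewrite ij => /(mulIf (invr_neq0 (np _))) e; by rewrite e eqxx in n12.
  - have [ij|ij] := eqVneq (i : nat) j; last first.
      by have := hd _ _ _ _ i2 i1 (lt2 i) (lt1 j) ij; rewrite e eqxx.
    move: e; rewrite ij => /(mulIf (invr_neq0 (np _))) e; by rewrite e eqxx in n12.
  - congr inr; apply/val_inj; apply: contra_eq e => ne; exact: hd.
have x0 i : x i != 0 by case: i => i; rewrite mulf_neq0 // invr_neq0.
have sP : (size P < #|{: 'I_m1.+1 + 'I_m2.+1}|)%N.
  rewrite card_sum !card_ord; apply: leq_ltn_trans (size_polyMleq _ _) _.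
  by case: (_ + _)%N (leq_add (sB a1 m1) (sB a2 m2)) => [|u] // /leq_trans; apply;
    rewrite addSn addnS.
have := residue_sum xi x0 sP; rewrite big_sumType /=.
set S1 := \sum_(i < m1.+1) _; set S2 := \sum_(i < m2.+1) _ => e.
have r a b (i j : nat) : b != 0 -> a / p ^+ i / (b / p ^+ j) = a / p ^+ i * (p ^+ j / b).
  by move=> b0; field; rewrite b0 !np.
have -> : \sum_(k < m1.+1) (a1 / p ^+ k) *
      (num_prod a1 p m1 (a1 / p ^+ k) * num_prod a2 p m2 (a1 / p ^+ k)) /
      (\prod_(j < m1.+1 | j != k) (1 - p ^+ j / p ^+ k) * den_prod a2 p m2 (a1 / p ^+ k)) = S1.
  apply: eq_bigr => k _; rewrite PE big_sumType /=; congr (_ / (_ * _)).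
    apply: eq_big => j; first by [].
    by move=> _; congr (1 - _); field; rewrite a10 !np.
  by apply: eq_big => j //; rewrite r.
have -> : \sum_(k < m2.+1) (a2 / p ^+ k) *
      (num_prod a2 p m2 (a2 / p ^+ k) * num_prod a1 p m1 (a2 / p ^+ k)) /
      (\prod_(j < m2.+1 | j != k) (1 - p ^+ j / p ^+ k) * den_prod a1 p m1 (a2 / p ^+ k)) = S2.
  apply: eq_bigr => k _; rewrite PE big_sumType /= [num_prod a2 _ _ _ * _]mulrC.
  rewrite [\prod_(j < m2.+1 | _) _ * _]mulrC; congr (_ / (_ * _)).
    by apply: eq_big => j //; rewrite r.
  apply: eq_big => j; first by [].
  by move=> _; congr (1 - _); field; rewrite a20 !np.
have -> : S2 = - S1 by apply/eqP; rewrite -addr_eq0 addrC e.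
by ring.
Qed.

End Blocks.

(** * Products and sums over n-th roots of unity *)

Section RootOfUnity.
Variables (C : numFieldType) (n : nat) (w : C).
Hypothesis pw : n.-primitive_root w.

Let n0 : (0 < n)%N := prim_order_gt0 pw.

Lemma prim_neq0 : w != 0.
Proof.
apply/eqP => w0; have := prim_expr_order pw.
by rewrite w0 expr0n gtn_eqF // => /esym/eqP; rewrite oner_eq0.
Qed.

Lemma prim_inj i j : (i < n)%N -> (j < n)%N -> (w ^+ i == w ^+ j) = (i == j).
Proof. by move=> li lj; rewrite (eq_prim_root_expr pw) !modn_small. Qed.

Lemma prod_prim t : \prod_(j < n) (1 - t * w ^+ j) = 1 - t ^+ n.
Proof.
have [->|t0] := eqVneq t 0.
  rewrite expr0n gtn_eqF // subr0 big1 // => j _; by rewrite mul0r subr0.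
have /(congr1 (fun q => q.[t^-1])) := factor_Xn_sub_1 pw.
rewrite big_mkord horner_prod !(hornerD, hornerN, hornerXn, hornerC) => e.
have -> : 1 - t ^+ n = t ^+ n * (t^-1 ^+ n - 1).
  by rewrite mulrBr mulr1 -exprMn divff // expr1n.
rewrite -e; have -> : t ^+ n = \prod_(j < n) t by rewrite prodr_const card_ord.
rewrite -big_split; apply: eq_bigr => j _ /=.
by rewrite !(hornerD, hornerN, hornerX, hornerC) mulrBr divff.
Qed.

Lemma sum_prim r : \sum_(k < n) (w ^+ r) ^+ k = if (n %| r)%N then n%:R else 0.
Proof.
case: ifP => [|ndiv].
  by rewrite (prim_order_dvd pw) => /eqP ->; exact: (@geom1 C n).
have nr : 1 - w ^+ r != 0 by rewrite subr_eq0 eq_sym -(prim_order_dvd pw) ndiv.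
apply: (mulfI nr); rewrite [LHS](geomE n (w ^+ r)) mulr0 exprAC (prim_expr_order pw).
by rewrite expr1n subrr.
Qed.

(* Summing over the n-th roots of unity extracts the coefficients of index
   congruent to -1; as the size is below [2 n], only index [n - 1] survives. *)
Lemma sum_prim_poly (P : {poly C}) t : (size P <= n.*2.-1)%N ->
  \sum_(k < n) (w ^+ k)^-1 * P.[t * (w ^+ k)^-1] = n%:R * P`_n.-1 * t ^+ n.-1.
Proof.
move=> sP; have wn0 := prim_neq0.
under eq_bigr => k _ do rewrite (horner_coef_wide _ sP) mulr_sumr.
rewrite exchange_big /=.
have e (r : 'I_(n.*2.-1)) : \sum_(k < n) (w ^+ k)^-1 * (P`_r * (t * (w ^+ k)^-1) ^+ r) =
    if (r == n.-1 :> nat) then n%:R * P`_n.-1 * t ^+ n.-1 else 0.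
  have e1 : \sum_(k < n) (w ^+ k)^-1 ^+ r.+1 = if (n %| r.+1)%N then n%:R else 0.
    transitivity (w ^+ r.+1 * \sum_(k < n) (w ^+ r.+1) ^+ k).
      rewrite [in RHS](reindex_inj rev_ord_inj) /= mulr_sumr; apply: eq_bigr => k _.
      rewrite -exprS subnSK // exprVn -exprM -exprM.
      apply: (mulIf (expf_neq0 (k * r.+1) wn0)); rewrite mulVf ?expf_neq0 //.
      by rewrite [(k * _)%N]mulnC -exprD -mulnDr subnK 1?ltnW // mulnC exprM (prim_expr_order
        pw) expr1n.
    by rewrite sum_prim; case: ifP; rewrite ?mulr0 // (prim_order_dvd pw) => /eqP ->;
      rewrite mul1r.
  transitivity (P`_r * t ^+ r * \sum_(k < n) (w ^+ k)^-1 ^+ r.+1).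
    rewrite mulr_sumr; apply: eq_bigr => k _; rewrite exprMn exprS; ring.
  rewrite e1; case: (eqVneq (r : nat) n.-1) => [-> | nr].
    by rewrite prednK // dvdnn; ring.
  rewrite ifF ?mulr0 //; apply/negP => /dvdnP [q eq].
  move/eqP: nr => nr; have := ltn_ord r; move: nr eq; move: (nat_of_ord r) => r'.
  by case: q => [|[|q]]; rewrite ?mulSn -mul2n; have := n0; rewrite ?mul0n; lia.
under eq_bigr => r _ do rewrite e.
rewrite -big_mkcond /=.
have ln : (n.-1 < n.*2.-1)%N by have := n0; lia.
by rewrite (big_pred1 (Ordinal ln)) // => r; rewrite /= -val_eqE.
Qed.

(** At a primitive root, [den_prod] consists of m + 1 of the n linear factors of 1 - t^n. The n - m
    - 1 others and the m factors of [num_prod] make a polynomial of degree at most n - 1. *)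
Lemma num_den_poly m : (m < n)%N ->
  exists2 P : {poly C}, (size P <= n)%N &
   forall t, t != 0 -> t ^+ n != 1 -> (1 - t ^+ n) *
     (num_prod 1 w m t / den_prod 1 w m t) = P.[t].
Proof.
move=> mn.
have s2 c : (size (1 - c%:P * 'X : {poly C})%R <= 2)%N.
  rewrite (leq_trans (size_polyD _ _)) // size_polyN geq_max size_poly1 /=.
  by rewrite mul_polyC (leq_trans (size_scale_leq _ _)) // size_polyX.
have sB (c : nat -> C) M : (size (\prod_(j < M) (1 - (c j)%:P * 'X))%R <= M.+1)%N.
  elim: M => [|M IH]; first by rewrite big_ord0 size_poly1.
  rewrite big_ord_recr /=; apply: leq_trans (size_polyMleq _ _) _.
  by rewrite -ltnS; case: (_ + _)%N (leq_add IH (s2 (c M))) => [|u] //; rewrite addn2.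
have hB (c : nat -> C) M t : (\prod_(j < M) (1 - (c j)%:P * 'X)).[t]
  = \prod_(j < M) (1 - t * c j).
  rewrite horner_prod; apply: eq_bigr => j _.
  by rewrite !(hornerD, hornerN, hornerM, hornerX, hornerC) mulrC.
exists (\prod_(j < m) (1 - (1 / w ^+ j.+1)%:P * 'X) *
        \prod_(j < n - m.+1) (1 - (w ^+ (m.+1 + j))%:P * 'X)).
  apply: leq_trans (size_polyMleq _ _) _.
  have := leq_add (sB (fun j => 1 / w ^+ j.+1) m) (sB (fun j => w ^+ (m.+1 + j)) (n - m.+1)%N).
  case: (size _ + size _)%N => [|u] //= h; rewrite -ltnS (leq_trans h) //.
  by rewrite addSn addnS -addSn subnKC.
move=> t t0 tn; rewrite hornerM (hB (fun j => 1 / w ^+ j.+1)) (hB (fun j => w ^+ (m.+1 + j))%N).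
have e : \prod_(j < m.+1) (1 - t * w ^+ j) *
  \prod_(j < n - m.+1) (1 - t * w ^+ (m.+1 + j)%N) = 1 - t ^+ n.
  rewrite -prod_prim -!(big_mkord xpredT (fun j => 1 - t * w ^+ j)).
  rewrite -(big_mkord xpredT (fun j => 1 - t * w ^+ (m.+1 + j)%N)).
  rewrite (@big_cat_nat _ _ _ m.+1 0 n) //=; congr (_ * _).
  rewrite [in RHS](_ : m.+1 = 0 + m.+1)%N // big_addn; apply: eq_bigr => j _; by rewrite addnC.
have nD : \prod_(j < m.+1) (1 - t * w ^+ j) != 0.
  by apply: contra_neq tn => z; move: e; rewrite z mul0r => /esym/eqP; rewrite subr_eq0 => /eqP.
have -> : den_prod 1 w m t = \prod_(j < m.+1) (1 - t * w ^+ j).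
  by apply: eq_bigr => j _; rewrite divr1.
rewrite -e /num_prod; move: (\prod_(j < m.+1) _) nD => D nD; field; exact: nD.
Qed.

(** The summand is w^(-k) times a polynomial of degree at most 2 n - 2 evaluated at t w^(-k).
    Summation over k keeps only the monomial t^(n-1), which the prefactor t / t^n cancels. *)
Lemma block_fun_prim_const m1 m2 : (m1 < n)%N -> (m2 < n)%N ->
  exists c : C, forall t, t != 0 -> t ^+ n != 1 -> block_fun n w 1 m1 1 m2 t = c.
Proof.
move=> l1 l2; have [P1 s1 e1] := num_den_poly l1; have [P2 s2 e2] := num_den_poly l2.
exists (n%:R * (P1 * P2)`_n.-1) => t t0 tn.
have w0 := prim_neq0.
have BE m P k : (forall t, t != 0 -> t ^+ n != 1 ->
  (1 - t ^+ n) * (num_prod 1 w m t / den_prod 1 w m t) = P.[t]) ->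
    block_factor n 1 w m k t = P.[t * (w ^+ k)^-1].
  move=> h; rewrite /block_factor den_partE //; last by apply: contraNneq tn => <-;
    rewrite expr1n.
  rewrite invr1 mulr1 -h.
  - rewrite exprMn exprVn exprAC (prim_expr_order pw) expr1n invr1 mulr1.
    rewrite -geomE; ring.
  - by rewrite mulf_neq0 // invr_neq0 // expf_neq0.
  - by rewrite exprMn exprVn exprAC (prim_expr_order pw) expr1n invr1 mulr1.
rewrite /block_fun; under eq_bigr => k _ do rewrite (BE _ _ _ e1) (BE _ _ _ e2) -hornerM.
rewrite sum_prim_poly; last first.
  apply: leq_trans (size_polyMleq _ _) _; have := leq_add s1 s2.
  by case: (size _ + size _)%N => [|u] //=; rewrite -addnn; lia.
rewrite mulrCA -[RHS]mulr1; congr (_ * _).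
by rewrite mulrAC -exprS prednK // divff // expf_neq0.
Qed.

End RootOfUnity.

(** * Congruences modulo eps^3 *)

Section Congruences.
Variables (K : fieldType) (C : numFieldType) (hv : K -> C -> Prop) (eps : K).
Hypothesis pl : place hv eps.
Variables (n : nat) (p : K) (w : C).
Hypotheses (pw : n.-primitive_root w) (hp : hv p w).

Let n0 : (0 < n)%N := prim_order_gt0 pw.
Let w0 : w != 0 := prim_neq0 pw.
Let p0 : p != 0 := hv_neq0 pl hp w0.
Let nR : n%:R != 0 :> C. Proof. by rewrite pnatr_eq0 -lt0n. Qed.

Let hpX j : hv (p ^+ j) (w ^+ j). Proof. exact: (hvX pl). Qed.
Let wX j : w ^+ j != 0. Proof. exact: expf_neq0. Qed.

Lemma germ_sub1M A Ab B Bb : germ hv A Ab -> germ hv B Bb ->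
  germ hv (fun s => 1 - A s * B s) (fun t => 1 - Ab t * Bb t).
Proof.
move=> hA hB; have h1 := germ_cst pl (hv1 pl).
have hm := germ_cst pl (hvN pl (hv1 pl)).
apply: (germ_ext (germD pl h1 (germM pl hm (germM pl hA hB)))) => s /=;
by rewrite mulN1r.
Qed.

Lemma germ_geom m A Ab : germ hv A Ab ->
  germ hv (fun s => geom m (A s)) (fun t => geom m (Ab t)).
Proof. by move=> hA; apply: (germ_sum pl) => i _; apply: (germX pl). Qed.

(** Parameter and point are both germs, since either may be the variable: the point in
    [germ_block_summand], the parameter in [block_fun_eqmod_param]. *)
Lemma germ_block_factor m k A Ab S Sb : (m < n)%N -> (k < n)%N ->
  germ hv A Ab -> Ab 1 = 1 -> germ hv S Sb -> Sb 1 = 1 ->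
  germ hv (fun s => block_factor n (A s) p m k (S s)) (fun t =>
    block_factor n (Ab t) w m k (Sb t)).
Proof.
move=> lm lk hA A1 hS S1.
have hAV : germ hv (fun s => (A s)^-1) (fun t => (Ab t)^-1).
  by apply: (germV pl) => //; rewrite A1 oner_neq0.
have hc x a := @germ_cst K C hv eps pl x a.
have hpk : germ hv (fun=> (p ^+ k)^-1) (fun=> (w ^+ k)^-1) by apply/hc/(hvV pl).
rewrite /block_factor; apply: (germM pl); first apply: (germM pl).
- by apply: germ_geom; apply: (germM pl).
- apply: (germ_prod pl) => j _; apply: germ_sub1M; apply: (germM pl) => //.
  by apply/hc/(hvV pl).
rewrite /den_part; apply: (germM pl).
  case: (k <= m)%N; last exact: germ_sub1M.
  exact/hc/(hv1 pl).
apply: (germV pl).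
  apply: (germ_prod pl) => j _; apply: germ_sub1M => //; apply: (germM pl) => //.
  by apply/hc/(hvF pl).
apply/prodf_neq0 => j jk; rewrite S1 A1 mul1r divr1 subr_eq0.
apply: contraNneq jk => e.
have lj : (j < n)%N by apply: leq_trans (ltn_ord j) _.
by rewrite -(prim_inj pw lj lk) -[w ^+ k]mul1r e divfK.
Qed.

Lemma germ_block_summand k m1 m2 a1 a2 : (m1 < n)%N -> (m2 < n)%N -> (k < n)%N ->
  hv a1 1 -> hv a2 1 ->
  germ hv (fun s => s * (s ^+ n)^-1 * ((p ^+ k)^-1 * (block_factor n a1 p m1 k s * block_factor
    n a2 p m2 k s)))
          (fun s => s * (s ^+ n)^-1 * ((w ^+ k)^-1 * (block_factor n 1 w m1 k s * block_factor
            n 1 w m2 k s))).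
Proof.
move=> l1 l2 lk h1 h2.
have hi := germ_id pl.
apply: (germM pl); first apply: (germM pl) => //.
  apply: (germV pl); first exact: (germX pl).
  by rewrite expr1n oner_neq0.
apply: (germM pl); first by apply: (germ_cst pl); apply: (hvV pl).
apply: (germM pl); first exact: (germ_block_factor l1 lk (germ_cst pl h1) erefl hi erefl).
exact: (germ_block_factor l2 lk (germ_cst pl h2) erefl hi erefl).
Qed.

Lemma block_funE (F : fieldType) (q a1 a2 s : F) m1 m2 :
  block_fun n q a1 m1 a2 m2 s =
  \sum_(k < n) s * (s ^+ n)^-1 * ((q ^+ k)^-1 * (block_factor n a1 q m1 k s * block_factor n a2
    q m2 k s)).
Proof. by rewrite /block_fun mulr_sumr. Qed.

Lemma germ_block_fun m1 m2 a1 a2 : (m1 < n)%N -> (m2 < n)%N -> hv a1 1 -> hv a2 1 ->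
  germ hv (block_fun n p a1 m1 a2 m2) (block_fun n w 1 m1 1 m2).
Proof.
move=> l1 l2 h1 h2.
have : germ hv (fun s => \sum_(k < n) s * (s ^+ n)^-1 * ((p ^+ k)^-1 * (block_factor n a1 p m1
  k s * block_factor n a2 p m2 k s)))
  (fun s => \sum_(k < n) s * (s ^+ n)^-1 * ((w ^+ k)^-1 * (block_factor n 1 w m1 k s *
    block_factor n 1 w m2 k s))).
  by apply: (germ_sum pl) => k _; apply: germ_block_summand.
by move/germ_ext; apply => s; rewrite block_funE.
Qed.

Lemma block_fun_eqmod_param r m1 m2 a1 a1' a2 s : (m1 < n)%N -> (m2 < n)%N ->
  hv a1 1 -> hv a1' 1 -> hv a2 1 -> hv s 1 -> eqmod hv eps r a1 a1' ->
  eqmod hv eps r (block_fun n p a1 m1 a2 m2 s) (block_fun n p a1' m1 a2 m2 s).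
Proof.
move=> l1 l2 h1 h1' h2 hs e; apply: (eqmodMl pl).
  by exists 1; apply: (hv1M pl) => //; apply: (hv1V pl); apply: (hv1n pl).
apply: (eqmod_sum pl) => k _; apply: (eqmodMl pl); first by exists (w ^+ k)^-1; apply: (hvV pl).
have hB := germ_block_factor l2 (ltn_ord k) (germ_cst pl h2) erefl (germ_id pl) erefl.
have hg := germ_block_factor l1 (ltn_ord k) (germ_id pl) erefl (germ_cst pl hs) erefl.
apply: (eqmodM pl); last exact: (eqmod_refl pl).
- by exists (block_factor n 1 w m1 k 1); apply: (germ_hv pl hg h1').
- by exists (block_factor n 1 w m2 k 1); apply: (germ_hv pl hB hs).
- exact: (germ_eqmod pl hg).
Qed.

Lemma hv_perturb x a : hv x a -> hv (x + eps ^+ 3) a.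
Proof.
move=> hx; rewrite -[a]addr0; apply: (hvD pl) => //.
by have := hvX pl 3 (hv_eps pl); rewrite expr0n.
Qed.

Lemma eqmod_perturb x : eqmod hv eps 3 (x + eps ^+ 3) x.
Proof. by exists 1; split; [exists 1; apply: (hv1 pl) | rewrite mulr1; ring]. Qed.

Lemma perturb_neq x : x + eps ^+ 3 != x.
Proof. by rewrite -subr_eq0 addrC addKr expf_neq0 // (eps_neq0 pl). Qed.

(* When [a1 = a2] the two points coincide; moving [a1] by [eps ^+ 3] separates
   them without affecting anything modulo [eps ^+ 3]. *)
Lemma block_fun_eqmod m1 m2 a1 a2 s s' : (m1 < n)%N -> (m2 < n)%N ->
  hv a1 1 -> hv a2 1 -> hv s 1 -> hv s' 1 ->
  eqmod hv eps 3 (block_fun n p a1 m1 a2 m2 s) (block_fun n p a1 m1 a2 m2 s').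
Proof.
move=> l1 l2 h1 h2 hs hs'.
have [c hc] := block_fun_prim_const pw l1 l2.
have [b [hb nb cb]] : exists b, [/\ hv b 1, b != a2 & eqmod hv eps 3 b a1].
  have [->|ne] := eqVneq a1 a2; last by exists a1; split=> //; apply: (eqmod_refl pl).
  by exists (a2 + eps ^+ 3); split; [apply: hv_perturb | apply: perturb_neq |
    apply: eqmod_perturb].
have b0 : b != 0 by apply: (hv_neq0 pl hb); rewrite oner_neq0.
have a20 : a2 != 0 by apply: (hv_neq0 pl h2); rewrite oner_neq0.
have two : block_fun n p b m1 a2 m2 b = block_fun n p b m1 a2 m2 a2.
  apply: block_fun_two_values => // x y i j hx hy li lj ij.
  have hvxy z : z \in [:: b; a2] -> hv z 1 by rewrite !inE => /orP [] /eqP ->.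
  have h := hvB pl (hvF pl (hvxy _ hx) (hpX i) (wX i)) (hvF pl (hvxy _ hy) (hpX j) (wX j)).
  rewrite -subr_eq0; apply: (hv_neq0 pl h).
  by rewrite subr_eq0 !mul1r (inj_eq invr_inj) (prim_inj pw).
have key t (ht : hv t 1) : eqmod hv eps 3 (block_fun n p a1 m1 a2 m2 t) (block_fun n p b m1 a2
  m2 b).
  apply: (eqmod_trans pl (y := block_fun n p b m1 a2 m2 t)).
    by apply: (eqmod_sym pl); apply: block_fun_eqmod_param.
  exact: (germ_two_points pl (germ_block_fun l1 l2 hb h2) n0 hc hb h2 nb two ht).
by apply: (eqmod_trans pl (key s hs)); apply: (eqmod_sym pl); apply: key.
Qed.

(** The product of 1 - t p^(i-n) over 0 < i <= n, divided by 1 - t^n, after cancelling 1 - t. It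
    compares n consecutive factors of base p with one factor of base p^(n^2). *)
Definition Theta t := \prod_(i < n.-1) (1 - t * (p ^+ i.+1 / p ^+ n)) / geom n t.
Definition Theta_red t := \prod_(i < n.-1) (1 - t * (w ^+ i.+1 / w ^+ n)) / geom n t.

Lemma germ_Theta A Ab : germ hv A Ab -> Ab 1 = 1 ->
  germ hv (fun s => Theta (A s)) (fun t => Theta_red (Ab t)).
Proof.
move=> hA A1; apply: (germM pl).
  apply: (germ_prod pl) => i _; apply: germ_sub1M => //.
  by apply: (germ_cst pl); apply: (hvF pl).
by apply: (germV pl); [apply: germ_geom | rewrite A1 geom1].
Qed.

Lemma Theta_red1 t : t ^+ n != 1 -> Theta_red t = 1.
Proof.
move=> tn; have t1 : 1 - t != 0.
  by rewrite subr_eq0; apply: contraNneq tn => <-; rewrite expr1n.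
have ng : geom n t != 0.
  apply: contraNneq tn => e; have := geomE n t; rewrite e mulr0 => /esym/eqP.
  by rewrite subr_eq0 eq_sym.
apply: (mulfI t1); apply: (mulIf ng); rewrite /Theta_red mulr1 geomE -mulrA divfK //.
rewrite -(prod_prim pw) -(big_mkord xpredT (fun j => 1 - t * w ^+ j)).
have -> : index_iota 0 n = index_iota 0 n.-1.+1 by rewrite prednK.
rewrite big_nat_recl // big_mkord expr0 mulr1; congr (_ * _).
by apply: eq_bigr => i _; rewrite (prim_expr_order pw) divr1.
Qed.

Lemma Theta_hv t : hv t 1 -> hv (Theta t) (Theta_red 1).
Proof. exact: (germ_hv pl (germ_Theta (germ_id pl) erefl)). Qed.

Lemma Theta_eqmod r t t' : hv t 1 -> hv t' 1 -> eqmod hv eps r t t' ->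
  eqmod hv eps r (Theta t) (Theta t').
Proof. exact: (germ_eqmod pl (germ_Theta (germ_id pl) erefl)). Qed.

Lemma Theta_red_neq0 : Theta_red 1 != 0.
Proof.
rewrite /Theta_red mulf_neq0 ?invr_neq0 ?geom1 //; apply/prodf_neq0 => i _.
rewrite mul1r (prim_expr_order pw) divr1 subr_eq0 -(expr0 w) (prim_inj pw) //.
by have := ltn_ord i; lia.
Qed.

(** For b = 1 + eps^3, the function x |-> Theta(t x) Theta(t b / x) is invariant under x |-> b / x,
    hence equal at 1 and b, and its reduction is 1 off the roots of unity; [germ_two_points]
    applies. Taking b rather than 1 keeps the two points distinct, and is invisible modulo eps^3. *)
Lemma Theta_mult t a : hv t 1 -> hv a 1 ->
  eqmod hv eps 3 (Theta (t * a) * Theta (t * a^-1)) (Theta t ^+ 2).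
Proof.
move=> ht ha; pose b := 1 + eps ^+ 3.
have hb : hv b 1 by apply/hv_perturb/(hv1 pl).
have nb : 1 != b by rewrite eq_sym perturb_neq.
have b0 : b != 0 by apply: (hv_neq0 pl hb); rewrite oner_neq0.
have hi := germ_id pl.
have ni : id (1 : C) != 0 := oner_neq0 C.
have hgA : germ hv (fun x => t * x) (fun x => 1 * x) := germM pl (germ_cst pl ht) hi.
have hgB : germ hv (fun x => t * b * x^-1) (fun x => 1 * 1 * x^-1).
  exact: (germM pl (germM pl (germ_cst pl ht) (germ_cst pl hb)) (germV pl hi ni)).
have hg := germM pl (germ_Theta hgA (mulr1 1)) (germ_Theta hgB _).
have {}hg := hg (etrans (congr1 _ (invr1 _)) (etrans (mulr1 _) (mulr1 _))).
have fb1 x : x != 0 -> x ^+ n != 1 -> Theta_red (1 * x) * Theta_red (1 * 1 * x^-1) = 1.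
  move=> x0 xn; rewrite !mul1r !Theta_red1 ?mulr1 //.
  by rewrite exprVn -[X in _ != X]invr1 (inj_eq invr_inj).
have two : Theta (t * 1) * Theta (t * b * 1^-1) = Theta (t * b) * Theta (t * b * b^-1).
  by rewrite invr1 !mulr1 mulfK // mulrC.
have := germ_two_points pl hg n0 fb1 (hv1 pl) hb nb two ha.
rewrite invr1 !mulr1 => e.
have r1 x : hv x 1 -> regular hv (Theta x) by move=> hx; exists (Theta_red 1); apply: Theta_hv.
have cb x : hv x 1 -> eqmod hv eps 3 (Theta (x * b)) (Theta x).
  move=> hx; apply: Theta_eqmod => //; first exact: (hv1M pl).
  by rewrite -[X in eqmod _ _ _ _ X]mulr1; apply: (eqmodMl pl); [exists 1 | apply: eqmod_perturb].
have haV := hv1V pl ha.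
apply: (eqmod_trans pl (y := Theta (t * a) * Theta (t * b * a^-1))).
  apply: (eqmodMl pl); first by apply/r1/(hv1M pl).
  by apply: (eqmod_sym pl); rewrite mulrAC; apply/cb/(hv1M pl).
apply: (eqmod_trans pl e); rewrite expr2; apply: (eqmodMl pl); first exact: r1.
exact: cb.
Qed.

End Congruences.

(** * Factorization of a block of summands *)

Section Chain.
Variable F : fieldType.
Implicit Types a p t x : F.

Lemma qpochS a p k : qpoch a p k.+1 = qpoch a p k * (1 - a * p ^+ k).
Proof. by rewrite /qpoch big_nat_recr. Qed.

Lemma qpoch0 a p : qpoch a p 0 = 1.
Proof. by rewrite /qpoch big_nil. Qed.

Lemma qpochD a p k l : qpoch a p (k + l) = qpoch a p k * \prod_(j < l) (1 - a * p ^+ (k + j)).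
Proof.
elim: l => [|l IH]; first by rewrite addn0 big_ord0 mulr1.
by rewrite addnS qpochS IH big_ord_recr /= mulrA.
Qed.

Lemma num_prod_shift a p m t : p != 0 ->
  num_prod a p m (t / p) * (1 - t * a / p) = num_prod a p m t * (1 - t * a / p ^+ m.+1).
Proof.
move=> p0; elim: m => [|m IH]; first by rewrite /num_prod !big_ord0 !mul1r.
rewrite /num_prod !big_ord_recr /= -!/(num_prod _ _ _ _) mulrAC IH; congr (_ * (1 - _) * (1 - _)).
  by rewrite mulrA.
by rewrite !exprS; field; rewrite p0 expf_neq0.
Qed.

Lemma den_prod_shift a p m t : p != 0 -> a != 0 ->
  den_prod a p m (t / p) * (1 - t * p ^+ m / a) = den_prod a p m t * (1 - t / (p * a)).
Proof.
move=> p0 a0; elim: m => [|m IH].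
  rewrite /den_prod !big_ord1 /= [RHS]mulrC expr0; congr ((1 - _) * (1 - _)).
    by field; rewrite p0 a0.
  by rewrite mulrA.
rewrite /den_prod big_ord_recr [in RHS]big_ord_recr /= -!/(den_prod _ _ _ _).
have -> : 1 - t / p * (p ^+ m.+1 / a) = 1 - t * p ^+ m / a.
  by rewrite exprS; congr (1 - _); field; rewrite p0 a0.
by rewrite IH mulrAC mulrA.
Qed.

(** [a] is not a power of [p], negative exponents included; this keeps the denominators in
    [qpoch_pair] nonzero. *)
Definition indep a p := forall i j : nat, a * p ^+ i != p ^+ j.

(** Induction on [N], each step telescoping by the two shift lemmas. Replacing the parameters by a p
    and p / a, free of [m], costs p^(-N) and a rational function of p^(-N), which is how the
    variable s arises. *)
Lemma qpoch_pair a p m N : p != 0 -> a != 0 -> indep a p ->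
  qpoch (a / p ^+ m) p N * qpoch (p ^+ m.+1 / a) p N =
  qpoch (a * p) p N * qpoch (p / a) p N * (p ^+ N)^-1 *
  (num_prod a p m (p ^+ N)^-1 / den_prod a p m (p ^+ N)^-1) *
    (den_prod a p m 1 / num_prod a p m 1).
Proof.
move=> p0 a0 ha.
have np j : p ^+ j != 0 by rewrite expf_neq0.
have nN : num_prod a p m 1 != 0.
  apply/prodf_neq0 => j _; rewrite mul1r subr_eq0; apply: contra (ha 0%N j.+1) => /eqP e.
  by rewrite expr0 mulr1 -[p ^+ _]mul1r e divfK.
have nD N' : den_prod a p m (p ^+ N')^-1 != 0.
  apply/prodf_neq0 => j _; rewrite subr_eq0; apply: contra (ha N' j) => /eqP e.
  by rewrite -[a * _]mulr1 e; apply/eqP; field; rewrite a0 np.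
have nD1 : den_prod a p m 1 != 0 by have := nD 0%N; rewrite expr0 invr1.
elim: N => [|N IH].
  by rewrite !qpoch0 expr0 invr1; field; rewrite nD1 nN.
rewrite !qpochS.
have -> : forall x y z t : F, x * y * (z * t) = x * z * (y * t) by move=> *; ring.
rewrite IH.
have e1 := num_prod_shift a m (p ^+ N)^-1 p0; have e2 := den_prod_shift m (p ^+ N)^-1 p0 a0.
have -> : (p ^+ N.+1)^-1 = (p ^+ N)^-1 / p by rewrite exprSr invfM mulrC.
have n1 : 1 - (p ^+ N)^-1 * a / p != 0.
  rewrite subr_eq0; apply: contra (ha 0%N N.+1) => /eqP e; rewrite expr0 mulr1.
  by apply/eqP; rewrite exprS -[p * _]mulr1 e; field; rewrite p0 np.
have n2 : 1 - (p ^+ N)^-1 / (p * a) != 0.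
  rewrite subr_eq0; apply: contra (ha N.+1 0%N) => /eqP e; rewrite expr0.
  by apply/eqP; rewrite -[LHS]mulr1 [in LHS]e exprS; field; rewrite p0 np a0.
have n3 : 1 - (p ^+ N)^-1 * p ^+ m / a != 0.
  rewrite subr_eq0; apply: contra (ha N m) => /eqP e.
  by rewrite -[a * _]mulr1 e; apply/eqP; field; rewrite a0 np.
have nDp := nD N.
have nDs : den_prod a p m ((p ^+ N)^-1 / p) != 0 by have := nD N.+1; rewrite exprSr invfM mulrC.
have -> : num_prod a p m ((p ^+ N)^-1 / p) =
    num_prod a p m (p ^+ N)^-1 * (1 - (p ^+ N)^-1 * a / p ^+ m.+1) / (1 - (p ^+ N)^-1 * a / p).
  by rewrite -e1 mulfK.
have -> : (den_prod a p m ((p ^+ N)^-1 / p))^-1 =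
    (den_prod a p m (p ^+ N)^-1)^-1 * (1 - (p ^+ N)^-1 * p ^+ m / a) / (1 - (p ^+ N)^-1 / (p *
      a)).
  have -> : den_prod a p m ((p ^+ N)^-1 / p) =
      den_prod a p m (p ^+ N)^-1 * (1 - (p ^+ N)^-1 / (p * a)) / (1 - (p ^+ N)^-1 * p ^+ m / a).
    by rewrite -e2 mulfK.
  by rewrite !invfM invrK mulrAC.
move: (num_prod a p m _) (den_prod a p m 1) (num_prod a p m 1) (den_prod a p m _) nDp nN =>
  X D1 N1 D nD' nN1.
move: (qpoch _ _ _) (qpoch _ _ _) => Q1 Q2.
have n1' : p ^+ N * p - a != 0.
  by rewrite subr_eq0 eq_sym; have := ha 0%N N.+1; rewrite expr0 mulr1 exprSr.
have n2' : p ^+ N * (p * a) - 1 != 0.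
  by rewrite subr_eq0; have := ha N.+1 0%N; rewrite expr0 exprSr mulrC -mulrA.
rewrite !exprS; move: (p ^+ N) (p ^+ m) (np N) (np m) n1' n2' => x y x0 y0 n1' n2'.
by field; rewrite ?x0 ?y0 ?a0 ?p0 ?nD' ?nN1 ?n1' ?n2'.
Qed.

End Chain.

(** * Splitting the summand of index n l + k *)

Section BlockFormula.
Variable F : fieldType.
Implicit Types a p t x : F.

Lemma Theta_block x p n l : p != 0 -> (0 < n)%N -> (x * p ^+ (n * l.+1)) ^+ n != 1 ->
  \prod_(i < n) (1 - x * p * p ^+ (n * l + i)) =
  (1 - (x * p ^+ (n * l.+1)) ^+ n) * Theta n p (x * p ^+ (n * l.+1)).
Proof.
move=> p0; case: n => // n _; set w := x * _ => nw.
have ng : geom n.+1 w != 0.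
  apply: contraNneq nw => e; have := geomE n.+1 w; rewrite e mulr0 => /esym/eqP.
  by rewrite subr_eq0 eq_sym.
rewrite big_ord_recr /= /Theta /= -geomE.
have -> : 1 - x * p * p ^+ (n.+1 * l + n) = 1 - w.
  by rewrite /w -mulrA -exprS; congr (1 - _ * _ ^+ _); rewrite mulnS; lia.
rewrite [RHS]mulrC -mulrA [_^-1 * _]mulrC mulfK // mulrC [RHS]mulrC; congr (_ * _).
apply: eq_bigr => i _; congr (1 - _).
have np : p ^+ n.+1 != 0 by rewrite expf_neq0.
rewrite /w; have -> : p ^+ (n.+1 * l.+1) = p ^+ n.+1 * p ^+ (n.+1 * l).
  by rewrite mulnS exprD.
rewrite exprD; move: (p ^+ n.+1) np => y y0; rewrite exprS; field; exact: y0.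
Qed.

Lemma qpoch_blocks x p n l k : p != 0 -> (0 < n)%N ->
  (forall i, (x * p ^+ (n * i.+1)) ^+ n != 1) ->
  qpoch (x * p) p (n * l + k) =
  qpoch (x ^+ n * (p ^+ n) ^+ n) ((p ^+ n) ^+ n) l *
  \prod_(i < l) Theta n p (x * p ^+ (n * i.+1)) *
  \prod_(j < k) (1 - x * p ^+ (n * l) * p ^+ j.+1).
Proof.
move=> p0 n0 h; rewrite qpochD; congr (_ * _); last first.
  by apply: eq_bigr => j _; rewrite exprD exprS; congr (1 - _); ring.
elim: l => [|l IH]; first by rewrite muln0 !qpoch0 big_ord0 mulr1.
rewrite mulnS addnC qpochD IH Theta_block // qpochS big_ord_recr /=.
have -> : (x * p ^+ (n * l.+1)) ^+ n = x ^+ n * (p ^+ n) ^+ n * ((p ^+ n) ^+ n) ^+ l.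
  by rewrite -mulrA -exprS exprMn -!exprM; congr (_ * _ ^+ _); lia.
ring.
Qed.

Definition shift_ratio a p u j :=
  (1 - u * (a * p ^+ j.+1)) * (1 - u * (a^-1 * p ^+ j.+1)) / (1 - u * p ^+ j.+1) ^+ 2.
Definition block_ratio n a p l k :=
  (\prod_(i < l) (Theta n p (p ^+ (n * i.+1) * a) * Theta n p (p ^+ (n * i.+1) * a^-1) /
     Theta n p (p ^+ (n * i.+1)) ^+ 2)) * \prod_(j < k) shift_ratio a p (p ^+ (n * l)) j.
(** The constants left by [qpoch_pair] in bases p and p^(n^2). The factor 1 - 1 / a of
    [den_prod a p m 1], which reduces to 0, has been cancelled against 1 - a^(-n), leaving
    [geom n (a^-1)], which reduces to n. *)
Definition block_unit n a p m :=
  \prod_(j < m) (1 - 1 * (p ^+ j.+1 / a)) / (num_prod a p m 1 * geom n (a^-1)).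

Lemma prod_frac l (A B D : nat -> F) :
  \prod_(i < l) (A i * B i / D i ^+ 2) =
  (\prod_(i < l) A i) * (\prod_(i < l) B i) / (\prod_(i < l) D i) ^+ 2.
Proof. by rewrite !big_split /= prodfV prodrXl. Qed.

Lemma block_ratioE n a p l k : block_ratio n a p l k =
  (\prod_(i < l) Theta n p (a * p ^+ (n * i.+1))) *
  (\prod_(i < l) Theta n p (a^-1 * p ^+ (n * i.+1))) /
  (\prod_(i < l) Theta n p (1 * p ^+ (n * i.+1))) ^+ 2 *
  ((\prod_(j < k) (1 - a * p ^+ (n * l) * p ^+ j.+1)) *
   (\prod_(j < k) (1 - a^-1 * p ^+ (n * l) * p ^+ j.+1)) /
   (\prod_(j < k) (1 - 1 * p ^+ (n * l) * p ^+ j.+1)) ^+ 2).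
Proof.
rewrite -(prod_frac l (fun i => Theta n p (a * p ^+ (n * i.+1)))
  (fun i => Theta n p (a^-1 * p ^+ (n * i.+1))) (fun i => Theta n p (1 * p ^+ (n * i.+1)))).
rewrite -(prod_frac k (fun j => 1 - a * p ^+ (n * l) * p ^+ j.+1)
  (fun j => 1 - a^-1 * p ^+ (n * l) * p ^+ j.+1) (fun j => 1 - 1 * p ^+ (n * l) * p ^+ j.+1)).
congr (_ * _); apply: eq_bigr => i _.
  by rewrite mul1r ![p ^+ _ * _]mulrC.
by rewrite /shift_ratio mul1r; congr ((1 - _) * (1 - _) / _); ring.
Qed.

Lemma block_pair n a p m l k : p != 0 -> a != 0 -> (0 < n)%N ->
  indep a p -> indep (a ^+ n) p -> (forall i, (0 < i)%N -> p ^+ i != 1) ->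
  qpoch (a / p ^+ m) p (n * l + k) * qpoch (p ^+ m.+1 / a) p (n * l + k) /
    qpoch p p (n * l + k) ^+ 2 =
  qpoch (a ^+ n) ((p ^+ n) ^+ n) l * qpoch ((p ^+ n) ^+ n / a ^+ n) ((p ^+ n) ^+ n) l /
    qpoch ((p ^+ n) ^+ n) ((p ^+ n) ^+ n) l ^+ 2 *
  (block_unit n a p m * block_ratio n a p l k * block_factor n a p m k (p ^+ (n * l))^-1) *
  (((p ^+ n) ^+ n) ^+ l / p ^+ (n * l + k)).
Proof.
move=> p0 a0 n0 ha han hp.
set P := (p ^+ n) ^+ n; set s := (p ^+ (n * l))^-1.
have P0 : P != 0 by rewrite !expf_neq0.
have np j : p ^+ j != 0 by rewrite expf_neq0.
have hanP : indep (a ^+ n) P by move=> i j; rewrite /P -!exprM.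
have An0 : a ^+ n != 0 by rewrite expf_neq0.
have hw i : (p ^+ (n * i.+1)) ^+ n != 1 by rewrite -exprM hp // !muln_gt0 n0.
have hwa i : (a * p ^+ (n * i.+1)) ^+ n != 1.
  by rewrite exprMn -exprM -(expr0 p); apply: han.
have hwv i : (a^-1 * p ^+ (n * i.+1)) ^+ n != 1.
  rewrite exprMn -exprM exprVn; apply: contra (han 0%N (n * i.+1 * n)%N) => /eqP e.
  by rewrite expr0 mulr1 -[X in X == _]mulr1 -e mulVKf.
(* With m = 0 in base P, this replaces the parameter A = a^n of c' by A P, the one produced by the
   complete blocks. *)
have := qpoch_pair 0 l P0 An0 hanP; rewrite {1}expr0 divr1 expr1 => ->.
have ePa : P / a ^+ n = a^-1 ^+ n * P by rewrite exprVn mulrC.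
have -> : qpoch p p (n * l + k) = qpoch (1 * p) p (n * l + k) by rewrite mul1r.
rewrite qpoch_pair // [p / a]mulrC ePa !qpoch_blocks //; last by move=> i; rewrite mul1r.
rewrite expr1n mul1r -/P.
rewrite block_ratioE.
have sk : (p ^+ (n * l + k))^-1 = s * (p ^+ k)^-1 by rewrite exprD invfM.
have sn : s ^+ n = (P ^+ l)^-1 by rewrite /s /P exprVn -!exprM; congr (_ ^+ _)^-1; lia.
have nas : a != s.
  apply: contraNneq (ha (n * l)%N 0%N) => ->; by rewrite expr0 /s mulVf.
have nasn : 1 - (P ^+ l)^-1 * (a ^+ n)^-1 != 0.
  rewrite subr_eq0; apply: contra (hanP l 0%N) => /eqP e; apply/eqP.
  by rewrite expr0 -[LHS]mulr1 [in LHS]e -invfM mulrC [P ^+ l * _]mulrC mulVf // mulf_neq0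
    ?expf_neq0.
have nav : 1 - (a ^+ n)^-1 != 0.
  rewrite subr_eq0; apply: contra (han 0%N 0%N) => /eqP e; apply/eqP.
  by rewrite !expr0 mulr1 -[LHS]invrK -e invr1.
have nav1 : 1 - a^-1 != 0.
  by rewrite subr_eq0; apply: contraNneq nav => e; rewrite -exprVn -e expr1n subrr.
have ng : geom n a^-1 != 0.
  by apply: contraNneq nav => e; rewrite -exprVn -geomE e mulr0.
have eBf : block_factor n a p m k s = (1 - (P ^+ l)^-1 * (a ^+ n)^-1) *
    (num_prod a p m (p ^+ (n * l + k))^-1 / den_prod a p m (p ^+ (n * l + k))^-1).
  by rewrite /block_factor den_partE // sk -sn -(exprVn a n) -exprMn -geomE; ring.
have eD1 : den_prod a p m 1 = (1 - a^-1) * \prod_(j < m) (1 - 1 * (p ^+ j.+1 / a)).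
  by rewrite /den_prod big_ord_recl /= !mul1r.
have e0 : num_prod (a ^+ n) P 0 (P ^+ l)^-1 = 1 by rewrite /num_prod big_ord0.
have e01 : num_prod (a ^+ n) P 0 1 = 1 by rewrite /num_prod big_ord0.
have e2 : den_prod (a ^+ n) P 0 (P ^+ l)^-1 = 1 - (P ^+ l)^-1 * (a ^+ n)^-1.
  by rewrite /den_prod big_ord1 expr0 div1r.
have e3 : den_prod (a ^+ n) P 0 1 = (1 - a^-1) * geom n a^-1.
  by rewrite /den_prod big_ord1 expr0 div1r mul1r geomE exprVn.
rewrite eBf eD1 e0 e01 e2 e3 /block_unit !div1r !divr1 !invfM.
move: (num_prod a p m 1)^-1 (qpoch P P l)^-1 => N1 Q1.
have nPl : P ^+ l != 0 by rewrite expf_neq0.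
move: (1 - (P ^+ l)^-1 / a ^+ n) nasn => E nE.
move: (num_prod a p m (p ^+ (n * l + k))^-1) (den_prod a p m (p ^+ (n * l + k))^-1)^-1 => N2 D2.
move: (p ^+ (n * l + k))^-1 => pN.
move: (qpoch (a ^+ n * P) P l) (qpoch (a^-1 ^+ n * P) P l) => QA QV.
move: (\prod_(i < l) Theta n p (a * p ^+ (n * i.+1))) => T1.
move: (\prod_(i < l) Theta n p (a^-1 * p ^+ (n * i.+1))) => T2.
move: (\prod_(i < l) Theta n p (1 * p ^+ (n * i.+1)))^-1 => T3.
move: (\prod_(j < k) (1 - 1 * p ^+ (n * l) * p ^+ j.+1))^-1 => G3.
move: (\prod_(j < k) (1 - a * p ^+ (n * l) * p ^+ j.+1)) => G1.
move: (\prod_(j < k) (1 - a^-1 * p ^+ (n * l) * p ^+ j.+1)) => G2.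
move: (\prod_(j < m) (1 - 1 * (p ^+ j.+1 / a))) => G4.
move: (geom n a^-1) ng (P ^+ l) nPl => g g0 Pl Pl0.
by field; rewrite g0 a0 nE Pl0.
Qed.

End BlockFormula.

(** * The congruence for one block *)

Section BlockSum.
Variables (K : fieldType) (C : numFieldType) (hv : K -> C -> Prop) (eps : K).
Hypothesis pl : place hv eps.
Variables (n : nat) (p : K) (w : C).
Hypotheses (pw : n.-primitive_root w) (hp : hv p w).

Let n0 : (0 < n)%N := prim_order_gt0 pw.
Let w0 : w != 0 := prim_neq0 pw.
Let p0 : p != 0 := hv_neq0 pl hp w0.
Let nR : n%:R != 0 :> C. Proof. by rewrite pnatr_eq0 -lt0n. Qed.
Let hpX j : hv (p ^+ j) (w ^+ j). Proof. exact: (hvX pl). Qed.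
Let wX j : w ^+ j != 0. Proof. exact: expf_neq0. Qed.
Let hpn l : hv (p ^+ (n * l)) 1.
Proof. by have := hpX (n * l); rewrite [w ^+ _]exprM (prim_expr_order pw) expr1n. Qed.
Let w1 j : (j.+1 < n)%N -> 1 - w ^+ j.+1 != 0.
Proof. by move=> lj; rewrite subr_eq0 -(expr0 w) (prim_inj pw). Qed.

Let prod_one m : \prod_(i < m) (1 : K) = 1. Proof. by rewrite big1. Qed.

(** With y = u p^(j+1), (1 - a y)(1 - y / a) = (1 - y)^2 - y (a - 1)^2 / a. The deviation from 1 is
    thus (a - 1)^2 / a, of order eps^2 and free of u, times a function of u that is fixed modulo
    eps. *)
Lemma shift_ratio_eqmod a u u' j : hv a 1 -> hv u 1 -> hv u' 1 -> (j.+1 < n)%N ->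
  eqmod hv eps 3 (shift_ratio a p u j) (shift_ratio a p u' j).
Proof.
move=> ha hu hu' lj.
have a0 : a != 0 by apply: (hv_neq0 pl ha); rewrite oner_neq0.
pose h x := x * p ^+ j.+1 / (1 - x * p ^+ j.+1) ^+ 2.
have hd x : hv x 1 -> hv (1 - x * p ^+ j.+1) (1 - w ^+ j.+1).
  by move=> hx; rewrite -[w ^+ _]mul1r; apply: (hvB pl (hv1 pl)); apply: (hvM pl).
have e x : hv x 1 -> shift_ratio a p x j = 1 - (a - 1) ^+ 2 / a * h x.
  move=> hx; have := hv_neq0 pl (hd x hx) (w1 lj); rewrite /shift_ratio /h => nd.
  by field; rewrite a0 nd.
have hh x : hv x 1 -> hv (h x) (w ^+ j.+1 / (1 - w ^+ j.+1) ^+ 2).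
  move=> hx; rewrite -[X in X / _]mul1r; apply: (hvF pl); first exact: (hvM pl).
    by apply: (hvX pl); apply: hd.
  by rewrite expf_neq0 // w1.
rewrite !e //; apply: (eqmodD pl); first exact: (eqmod_refl pl).
rewrite -(mulNr _ (h u)) -(mulNr _ (h u')).
have c2 : eqmod hv eps 2 (- ((a - 1) ^+ 2 / a)) 0.
  have [z [rz ez]] := eqmod1 pl ha (hv1 pl).
  exists (- (z ^+ 2 / a)); split.
    apply: (regularN pl); apply: (regularM pl); first exact: (regularX pl).
    by exists 1; apply: (hv1V pl).
  by rewrite subr0 ez expr1 exprMn; ring.
exact: (eqmod0M pl c2 (eqmod1 pl (hh u hu) (hh u' hu'))).
Qed.

Lemma shift_ratio_eqmod2 a u j : hv a 1 -> hv u 1 -> (j.+1 < n)%N ->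
  eqmod hv eps 2 (shift_ratio a p u j) 1.
Proof.
move=> ha hu lj.
have a0 : a != 0 by apply: (hv_neq0 pl ha); rewrite oner_neq0.
have hd : hv (1 - u * p ^+ j.+1) (1 - w ^+ j.+1).
  by rewrite -[w ^+ _]mul1r; apply: (hvB pl (hv1 pl)); apply: (hvM pl).
have nd := hv_neq0 pl hd (w1 lj).
have [z [rz ez]] := eqmod1 pl ha (hv1 pl).
exists (- (z ^+ 2 / a * (u * p ^+ j.+1 / (1 - u * p ^+ j.+1) ^+ 2))); split.
  apply: (regularN pl); apply: (regularM pl).
    by apply: (regularM pl); [apply: (regularX pl) | exists 1; apply: (hv1V pl)].
  exists (1 * w ^+ j.+1 / (1 - w ^+ j.+1) ^+ 2).
  apply: (hvF pl); [exact: (hvM pl) | exact: (hvX pl) | by rewrite expf_neq0 // w1].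
have -> : eps ^+ 2 * - (z ^+ 2 / a * (u * p ^+ j.+1 / (1 - u * p ^+ j.+1) ^+ 2)) =
  - ((a - 1) ^+ 2 / a * (u * p ^+ j.+1 / (1 - u * p ^+ j.+1) ^+ 2)).
  by rewrite ez expr1 exprMn; ring.
by rewrite /shift_ratio; field; rewrite a0 nd.
Qed.

(** Each complete block contributes 1 by [Theta_mult]; in the incomplete one p^(n l) may be replaced
    by 1. *)
Lemma block_ratio_eqmod a l k : hv a 1 -> (k < n)%N ->
  eqmod hv eps 3 (block_ratio n a p l k) (\prod_(j < k) shift_ratio a p 1 j).
Proof.
move=> ha lk; rewrite -[X in eqmod _ _ _ _ X]mul1r.
have lj (j : 'I_k) : (j.+1 < n)%N by apply: leq_ltn_trans lk.
have r1 j u : (j < k)%N -> hv u 1 -> regular hv (shift_ratio a p u j).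
  move=> jk hu; apply: (eqmod_regular pl (shift_ratio_eqmod2 ha hu _));
    first exact: leq_ltn_trans lk.
  by exists 1; apply: (hv1 pl).
have one : regular hv 1 by exists 1; apply: (hv1 pl).
apply: (eqmodM pl) => //.
- by apply: (regular_prod pl) => j _; apply: r1.
- rewrite -[X in eqmod _ _ _ _ X](prod_one l).
  apply: (eqmod_prod pl) => i _; split=> //.
  set t := p ^+ _; have ht : hv t 1 := hpn i.+1.
  have hT := Theta_hv pl pw hp ht; have nT := Theta_red_neq0 pl pw hp.
  have n1 : Theta n p t != 0 := hv_neq0 pl hT nT.
  rewrite -(@divff _ (Theta n p t ^+ 2)) ?expf_neq0 //.
  apply: (eqmodM pl).
  + by exists (Theta_red n w 1 ^+ 2); apply: (hvX pl).
  + by exists (Theta_red n w 1 ^+ 2)^-1; apply: (hvV pl); [apply: (hvX pl) | rewrite expf_neq0].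
  + exact: (Theta_mult pl pw hp).
  + exact: (eqmod_refl pl).
- apply: (eqmod_prod pl) => j _; split; first by apply: r1 => //; apply: (hv1 pl).
  by apply: shift_ratio_eqmod => //; apply: (hv1 pl).
Qed.

Lemma shift_ratio_prod_eqmod a k : hv a 1 -> (k < n)%N ->
  eqmod hv eps 2 (\prod_(j < k) shift_ratio a p 1 j) 1.
Proof.
move=> ha lk; rewrite -[X in eqmod _ _ _ _ X](prod_one k).
apply: (eqmod_prod pl) => j _; split; first by exists 1; apply: (hv1 pl).
by apply: shift_ratio_eqmod2 => //; [apply: (hv1 pl) | apply: leq_ltn_trans lk].
Qed.

Lemma regular_block_unit a m : hv a 1 -> (m < n)%N -> regular hv (block_unit n a p m).
Proof.
move=> ha lm; have haV := hv1V pl ha.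
apply: (regularM pl).
  apply: (regular_prod pl) => j _; exists (1 - 1 * (w ^+ j.+1 / 1)).
  apply: (hvB pl (hv1 pl)); apply: (hvM pl (hv1 pl)); apply: (hvF pl) => //.
  exact: oner_neq0.
exists (num_prod 1 w m 1 * geom n 1)^-1; apply: (hvV pl); last first.
  rewrite geom1 mulf_neq0 //; apply/prodf_neq0 => j _.
  rewrite !mul1r subr_eq0 eq_sym invr_eq1 eq_sym -subr_eq0 w1 //.
  exact: leq_ltn_trans lm.
apply: (hvM pl).
  apply: (hv_prod pl) => j _; apply: (hvB pl (hv1 pl)).
  by apply: (hvM pl (hv1 pl)); apply: (hvF pl).
by apply: (hv_sum pl) => j _; apply: (hvX pl).
Qed.

Definition hterm (F : fieldType) (q x1 y1 x2 y2 : F) k :=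
  qpoch x1 q k * qpoch y1 q k * qpoch x2 q k * qpoch y2 q k / qpoch q q k ^+ 4 * q ^+ k.

Lemma hterm_pair (F : fieldType) (q x1 y1 x2 y2 : F) k : hterm q x1 y1 x2 y2 k =
  (qpoch x1 q k * qpoch y1 q k / qpoch q q k ^+ 2) *
  (qpoch x2 q k * qpoch y2 q k / qpoch q q k ^+ 2) * q ^+ k.
Proof.
have -> : hterm q x1 y1 x2 y2 k = qpoch x1 q k * qpoch y1 q k * qpoch x2 q k * qpoch y2 q k /
  (qpoch q q k ^+ 2 * qpoch q q k ^+ 2) * q ^+ k by rewrite -exprD.
rewrite invfM; move: (qpoch q q k ^+ 2)^-1 => z; ring.
Qed.

Lemma block_sum a1 a2 m1 m2 l : hv a1 1 -> hv a2 1 -> (m1 < n)%N -> (m2 < n)%N ->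
  indep a1 p -> indep (a1 ^+ n) p -> indep a2 p -> indep (a2 ^+ n) p ->
  (forall i, (0 < i)%N -> p ^+ i != 1) ->
  let P := (p ^+ n) ^+ n in
  let c := hterm p (a1 / p ^+ m1) (p ^+ m1.+1 / a1) (a2 / p ^+ m2) (p ^+ m2.+1 / a2) in
  let c' := hterm P (a1 ^+ n) (P / a1 ^+ n) (a2 ^+ n) (P / a2 ^+ n) in
  regular hv (c' l) ->
  eqmod hv eps 3 (\sum_(k < n) c (n * l + k)%N) (c' l * \sum_(k < n) c k).
Proof.
move=> h1 h2 lm1 lm2 ha1 han1 ha2 han2 hpi P c c' rc'.
have a10 : a1 != 0 by apply: (hv_neq0 pl h1); rewrite oner_neq0.
have a20 : a2 != 0 by apply: (hv_neq0 pl h2); rewrite oner_neq0.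
pose X k s := s * (s ^+ n)^-1 * ((p ^+ k)^-1 * (block_factor n a1 p m1 k s * block_factor n a2
  p m2 k s)).
pose kp := block_unit n a1 p m1 * block_unit n a2 p m2.
pose R l' k := block_ratio n a1 p l' k * block_ratio n a2 p l' k.
pose S l' := (p ^+ (n * l'))^-1.
have np j : p ^+ j != 0 by rewrite expf_neq0.
have cE l' k : c (n * l' + k)%N = c' l' * (kp * (R l' k * X k (S l'))).
  rewrite /c hterm_pair !block_pair // /c' hterm_pair -/P /kp /R /X -/(S l').
  have Sn : (S l' ^+ n)^-1 = P ^+ l'.
    by rewrite /S /P exprVn invrK -!exprM; congr (_ ^+ _); lia.
  have eN : (p ^+ (n * l' + k))^-1 = S l' * (p ^+ k)^-1 by rewrite exprD invfM.
  rewrite Sn.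
  have -> : p ^+ (n * l' + k) = (S l' * (p ^+ k)^-1)^-1 by rewrite -eN invrK.
  have : S l' != 0 by rewrite invr_neq0.
  have : (p ^+ k)^-1 != 0 by rewrite invr_neq0.
  move: (S l') (p ^+ k)^-1 (P ^+ l') => s q Pl q0 s0.
  move: (qpoch _ _ _ * _ / _) (qpoch _ _ _ * _ / _) => E1 E2.
  move: (block_factor _ _ _ _ _ _) (block_factor _ _ _ _ _ _) (block_ratio _ _ _ _ _)
    (block_ratio _ _ _ _ _) => *.
  by field; rewrite q0 s0 oner_neq0.
have hS l' : hv (S l') 1 by apply: (hv1V pl); apply: hpn.
have gX k : (k < n)%N -> germ hv (X k) _ := fun lk =>
  germ_block_summand pl pw hp lm1 lm2 lk h1 h2.
have rX k l' : (k < n)%N -> regular hv (X k (S l')).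
  by move=> lk; have := germ_hv pl (gX k lk) (hS l') => h; eexists; exact: h.
have cX k l' : (k < n)%N -> eqmod hv eps 1 (X k (S l')) (X k (S 0%N)).
  by move=> lk; apply: (eqmod1 pl (germ_hv pl (gX k lk) (hS l')) (germ_hv pl (gX k lk) (hS 0%N))).
have one : regular hv 1 by exists 1; apply: (hv1 pl).
pose R0 k := (\prod_(j < k) shift_ratio a1 p 1 j) * (\prod_(j < k) shift_ratio a2 p 1 j).
have rG a k : hv a 1 -> (k < n)%N -> regular hv (\prod_(j < k) shift_ratio a p 1 j).
  by move=> ha lk; apply: (eqmod_regular pl (shift_ratio_prod_eqmod ha lk)).
have cR k l' : (k < n)%N -> eqmod hv eps 3 (R l' k) (R0 k).
  move=> lk; have hR a : hv a 1 -> regular hv (block_ratio n a p l' k).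
    by move=> ha; apply: (eqmod_regular pl (block_ratio_eqmod l' ha lk)); apply: rG.
  by apply: (eqmodM pl); [apply: rG | apply: hR | apply: block_ratio_eqmod |
    apply: block_ratio_eqmod].
have cR0 k : (k < n)%N -> eqmod hv eps 2 (R0 k) 1.
  move=> lk; rewrite -[X in eqmod _ _ _ _ X]mul1r.
  by apply: (eqmodM pl) => //; [apply: rG | apply: shift_ratio_prod_eqmod |
    apply: shift_ratio_prod_eqmod].
have sX l' : \sum_(k < n) X k (S l') = block_fun n p a1 m1 a2 m2 (S l') by rewrite block_funE.
have key l' : eqmod hv eps 3 (\sum_(k < n) R l' k * X k (S l')) (\sum_(k < n) R0 k * X k (S 0%N)).
  apply: (eqmod_trans pl (y := \sum_(k < n) R0 k * X k (S l'))).
    apply: (eqmod_sum pl) => k _; apply: (eqmodM pl); last exact: (eqmod_refl pl).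
    - by apply: (regularM pl); apply: rG.
    - exact: rX.
    - exact: cR.
  (* The first sum is [block_fun], constant modulo eps^3. In the second, R0 - 1 has order eps^2 and
     X is constant modulo eps. *)
  have e s : \sum_(k < n) R0 k * X k s = \sum_(k < n) X k s + \sum_(k < n) (R0 k - 1) * X k s.
    by rewrite -big_split; apply: eq_bigr => k _ /=; ring.
  rewrite !e; apply: (eqmodD pl); first by rewrite !sX; apply: (block_fun_eqmod pl pw hp).
  apply: (eqmod_sum pl) => k _; apply: (eqmod0M pl (r := 2) (k := 1)); last exact: cX.
  have [z [rz ez]] := cR0 k (ltn_ord k).
  by exists z; rewrite subr0.
have c'0 : c' 0%N = 1.
  by rewrite /c' /hterm !qpoch0 expr1n !mul1r expr0 invr1 mul1r.
have e1 : \sum_(k < n) c (n * l + k)%N = c' l * (kp * \sum_(k < n) R l k * X k (S l)).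
  by rewrite !mulr_sumr; apply: eq_bigr => k _; rewrite cE.
have e2 : \sum_(k < n) c k = kp * \sum_(k < n) R 0%N k * X k (S 0%N).
  rewrite mulr_sumr; apply: eq_bigr => k _; have := cE 0%N k.
  by rewrite muln0 add0n c'0 mul1r.
rewrite e1 e2; apply: (eqmodMl pl) => //; apply: (eqmodMl pl).
  by apply: (regularM pl); apply: regular_block_unit.
by apply: (eqmod_trans pl (key l)); apply: (eqmod_sym pl); apply: key.
Qed.

End BlockSum.

(** * Positivity at a root of unity *)

Definition reR (x : algC) : algR := in_algR (Creal_Re x).
Definition imR (x : algC) : algR := in_algR (Creal_Im x).

Lemma imRM x y : imR (x * y) = reR x * imR y + reR y * imR x.
Proof. by apply/val_inj; rewrite /= ImM. Qed.

Lemma imRN x : imR (- x) = - imR x.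
Proof. by apply/val_inj; rewrite /= raddfN. Qed.

Lemma norm1_reR_imR x : `|x| = 1 -> reR x ^+ 2 + imR x ^+ 2 = 1.
Proof. by move=> nx; apply/val_inj; rewrite /= -!expr2 -normC2_Re_Im nx expr1n. Qed.

Lemma norm1_imRV x : `|x| = 1 -> imR x^-1 = - imR x.
Proof. by move=> nx; apply/val_inj; rewrite /= ImV nx expr1n divr1. Qed.

Lemma norm1_reRV x : `|x| = 1 -> reR x^-1 = reR x.
Proof. by move=> nx; apply/val_inj; rewrite /= ReV nx expr1n divr1. Qed.

Lemma norm1_imR0 x : `|x| = 1 -> imR x = 0 -> (x == 1) || (x == -1).
Proof.
move=> nx /(congr1 val) /= /Creal_ImP xR.
by rewrite -eqf_sqr expr1n -real_normK // nx expr1n.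
Qed.

Lemma norm_root1 (x : algC) m : (0 < m)%N -> x ^+ m = 1 -> `|x| = 1.
Proof.
move=> m0 xm; apply/eqP; rewrite -(@pexpr_eq1 _ _ m) ?normr_ge0 //.
by rewrite -normrX xm normr1.
Qed.

(** On the open upper half circle, y a < x b says that (x, y) has the smaller argument, and the
    cosine decreases on (0, pi). *)
Lemma half_turn (R : realFieldType) (a b x y : R) : a ^+ 2 + b ^+ 2 = 1 ->
  x ^+ 2 + y ^+ 2 = 1 -> 0 < b -> 0 < y -> y * a < x * b -> a < x.
Proof.
move=> e1 e2 b0 y0 h; rewrite ltNge; apply/negP => xa.
have [a0|a0] := leP 0 a.
  have yb : y < b.
    rewrite ltNge; apply/negP => byy; have : x * b <= a * y; last by nra.
    by apply: (le_trans (y := a * b)); nra.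
  have x0 : 0 < x by nra.
  by nra.
have yb : y <= b by rewrite leNgt; apply/negP => byy; nra.
nra.
Qed.

(* The witness is the [2n]-th root of unity of maximal real part in the open
   upper half-plane. *)
Lemma half_root_exists n : (1 < n)%N ->
  exists2 w : algC, w ^+ n = -1 & forall j, (0 < j < n)%N -> 0 < imR (w ^+ j).
Proof.
move=> n1; have n20 : (0 < n.*2)%N by rewrite double_gt0 ltnW.
have [z0 pz] := C_prim_root_exists n20.
pose U x := x ^+ n.*2 = 1 :> algC.
have U1 x : U x -> `|x| = 1 by apply: norm_root1.
have UM x y : U x -> U y -> U (x * y) by rewrite /U exprMn => -> ->; rewrite mulr1.
have UV x : U x -> U x^-1 by rewrite /U exprVn => ->; rewrite invr1.
have UN x : U x -> U (- x) by rewrite /U -mul2n !exprM sqrrN.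
have UX x j : U x -> U (x ^+ j) by rewrite /U exprAC => ->; rewrite expr1n.
have Uz : U z0 by apply: (prim_expr_order pz).
have zr : imR z0 != 0.
  apply/eqP => /(norm1_imR0 (U1 _ Uz)); rewrite -eqf_sqr expr1n -(prim_order_dvd pz).
  by move=> /dvdn_leq; rewrite -muln2; lia.
have [i0 hi0] : exists i : 'I_n.*2, 0 < imR (z0 ^+ i).
  have [y [Uy hy]] : exists y, U y /\ 0 < imR y.
    case: (ltrgt0P (imR z0)) zr => // h _; first by exists z0.
    by exists z0^-1; split; [apply: UV | rewrite norm1_imRV ?oppr_gt0 ?U1].
  by have [i ei] := prim_rootP pz Uy; exists i; rewrite -ei.
case: (@arg_maxP _ algR _ i0 (fun i : 'I_n.*2 => 0 < imR (z0 ^+ i)) (fun i : 'I_n.*2 =>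
  reR (z0 ^+ i)) hi0).
move=> iw; set w := z0 ^+ iw => hw maxw.
have Uw : U w by apply: UX.
have w0 : w != 0 by rewrite -normr_eq0 U1 // oner_neq0.
have max y : U y -> 0 < imR y -> reR y <= reR w.
  by move=> Uy; have [i ->] := prim_rootP pz Uy; apply: maxw.
(* Otherwise y would have a smaller argument than w, hence a larger real part. *)
have down y : U y -> 0 < imR y -> 0 <= imR (y / w).
  move=> Uy hy; rewrite leNgt; apply/negP => h.
  have : reR w < reR y; last by rewrite ltNge max.
  apply: (half_turn (norm1_reR_imR (U1 _ Uw)) (norm1_reR_imR (U1 _ Uy)) hw hy).
  by move: h; rewrite imRM norm1_imRV ?norm1_reRV ?U1 //; lra.
(* J is the first return of the powers of w to the real axis; it will turn out to be n. *)
have [J [J0 rJ minJ]] : exists J, [/\ (0 < J)%N, imR (w ^+ J) = 0 &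
    forall j, (0 < j < J)%N -> imR (w ^+ j) != 0].
  have ex : exists j, (0 < j)%N && (imR (w ^+ j) == 0).
    exists n.*2; rewrite n20 Uw; apply/eqP/val_inj; rewrite /=.
    by apply/Creal_ImP; apply: rpred1.
  case: (ex_minnP ex) => J /andP [J0 /eqP rJ] mJ; exists J; split=> // j /andP [j0 jJ].
  by apply/negP => h; have := mJ j; rewrite j0 h leqNgt jJ => /(_ isT).
(* If w^(j+2) were below the axis, [down] applied to - w^(j+2) would put - w^(j+1) on or above
   it. *)
have up j : (0 < j < J)%N -> 0 < imR (w ^+ j).
  elim: j => // -[|j] IH h; first by rewrite expr1.
  have hj : (0 < j.+1 < J)%N by lia.
  have := minJ _ h; case: (ltrgt0P (imR (w ^+ j.+2))) => // neg _.
  have := down _ (UN _ (UX _ j.+2 Uw)); rewrite exprSr in neg *.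
  by rewrite imRN oppr_gt0 mulNr mulfK // imRN oppr_ge0 => /(_ neg); rewrite leNgt IH.
have ri1 : imR 1 = 0 by apply/val_inj/Creal_ImP/rpred1.
have wJ : w ^+ J = -1.
  have /orP [/eqP w1|/eqP //] := norm1_imR0 (U1 _ (UX _ J Uw)) rJ.
  case: J J0 rJ minJ up w1 => // -[|J'] _ _ _ up w1.
    by move: hw; rewrite -[w]expr1 w1 ri1 ltxx.
  have e : w ^+ J'.+1 = w^-1 by apply: (mulIf w0); rewrite -exprSr w1 mulVf.
  by have := up J'.+1 (leqnn _); rewrite e norm1_imRV ?U1 // oppr_gt0 ltNge ltW.
(* By [down], repeated division by w cannot jump over the real axis; but after J divisions y has
   become - y, so some quotient is real. *)
have cross y : U y -> 0 < imR y -> (forall i, (i <= J)%N -> imR (y / w ^+ i) != 0) -> False.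
  move=> Uy hy ny.
  have pos i : (i <= J)%N -> 0 < imR (y / w ^+ i).
    elim: i => [|i IH] li; first by rewrite expr0 divr1.
    rewrite lt_def ny // exprSr invfM mulrA; apply: down; last exact/IH/ltnW.
    by apply/UM/UV/UX.
  by have := pos J (leqnn _); rewrite wJ invrN1 mulrN1 imRN oppr_gt0 ltNge ltW.
(* A real quotient of z0 or - z0 by a power of w is 1 or -1, and -1 = w^J. So w generates all 2n-th
   roots of unity, which forces J >= n. *)
have [a za] : exists a, z0 = w ^+ a.
  have [/existsP [i /eqP hi]|/existsPn nr] := boolP [exists i : 'I_J.+1, imR (z0 / w ^+ i) == 0].
    have Ui : U (z0 / w ^+ i) by apply/UM/UV/UX.
    have wi0 : w ^+ i != 0 by rewrite expf_neq0.
    have /orP [/eqP e|/eqP e] := norm1_imR0 (U1 _ Ui) hi.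
      by exists i; rewrite -[LHS](divfK wi0) e mul1r.
    by exists (J + i)%N; rewrite -[LHS](divfK wi0) e exprD wJ.
  have ny i : (i <= J)%N -> imR (z0 / w ^+ i) != 0.
    by move=> li; apply: (nr (Ordinal (n := J.+1) li)).
  case: (ltrgt0P (imR z0)) zr => // h _.
    by have := cross _ Uz h ny.
  have := cross (- z0) (UN _ Uz); rewrite imRN oppr_gt0 => /(_ h) [] i li.
  by rewrite mulNr imRN oppr_eq0 ny.
have nJ : (n <= J)%N.
  have : (n.*2 %| J.*2)%N.
    by rewrite (prim_order_dvd pz) za exprAC -mul2n mulnC exprM wJ sqrrN !expr1n.
  by move/dvdn_leq; rewrite double_gt0 leq_double; apply.
have Jn : (J <= n)%N.
  rewrite leqNgt; apply/negP => nlJ; have := minJ n; rewrite nlJ ltnW // => /(_ isT) /eqP; apply.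
  have : (w ^+ n) ^+ 2 = 1 by rewrite -exprM muln2; apply: Uw.
  move/eqP; rewrite -(expr1n _ 2) eqf_sqr => /orP [] /eqP ->; first by [].
  by rewrite imRN ri1 oppr0.
have eJ : J = n by apply/eqP; rewrite eqn_leq Jn nJ.
by exists w; rewrite -eJ.
Qed.

Section Positivity.
Variables (n : nat) (w : algC).
Hypotheses (n1 : (1 < n)%N) (wn : w ^+ n = -1).
Hypothesis wpos : forall j, (0 < j < n)%N -> 0 < imR (w ^+ j).

Let w2n : w ^+ n.*2 = 1. Proof. by rewrite -muln2 exprM wn sqrrN expr1n. Qed.
Let nw j : `|w ^+ j| = 1.
Proof.
rewrite normrX (@norm_root1 w n.*2) ?expr1n // double_gt0 ltnW //.
Qed.
Let w0 j : w ^+ j != 0. Proof. by rewrite -normr_eq0 nw oner_neq0. Qed.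
Let impos j : (0 < j < n)%N -> 0 < 'Im (w ^+ j). Proof. exact: wpos. Qed.

(** 1 - e^(2 i t) = - 2 i e^(i t) sin t: the passage from factors of Pochhammer symbols to sines. *)
Lemma one_sub_sqr (x : algC) : `|x| = 1 -> 1 - x ^+ 2 = - x * (2 * 'i * 'Im x).
Proof.
move=> nx; have x0 : x != 0 by rewrite -normr_eq0 nx oner_neq0.
have xc : x^* = x^-1 by rewrite invC_norm nx expr1n invr1 mul1r.
rewrite ImE xc; have e : 'i * 'i = -1 :> algC by rewrite -expr2 sqrCi.
have -> : 2 * 'i * ('i * (x^-1 - x) / 2%:R) = - (x^-1 - x).
  transitivity ('i * 'i * (x^-1 - x)); last by rewrite e mulN1r.
  by move: (x^-1 - x) => t; field.
by field.
Qed.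

Lemma half_root_prim : n.-primitive_root (w ^+ 2).
Proof.
rewrite /primitive_root_of_unity ltnW //=; apply/forallP => i /=.
rewrite unity_rootE -exprM mul2n; apply/eqP.
have [->|ne] := eqVneq i.+1 n; first by rewrite w2n eqxx.
apply/negbTE; rewrite eq_sym -subr_eq0 -muln2 exprM one_sub_sqr //.
rewrite !mulf_neq0 ?oppr_eq0 ?neq0Ci ?pnatr_eq0 //.
by rewrite gt_eqF // impos //= ltn_neqAle ne ltn_ord.
Qed.

(** With w = e^(i t), t = pi / n, and j for the index: sin((j - m) t) sin((j + m + 1) t) / sin((j +
    1) t)^2. *)
Definition tau m i := 'Im (w ^+ i / w ^+ m) * 'Im (w ^+ (i + m.+1)) / 'Im (w ^+ i.+1) ^+ 2.

Lemma pair_factor m i : (i.+1 < n)%N ->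
  (1 - 1 / (w ^+ 2) ^+ m * (w ^+ 2) ^+ i) * (1 - (w ^+ 2) ^+ m.+1 / 1 * (w ^+ 2) ^+ i) /
    (1 - w ^+ 2 * (w ^+ 2) ^+ i) ^+ 2 = w^-1 * tau m i.
Proof.
move=> li; have c0 : 'Im (w ^+ i.+1) != 0 by rewrite gt_eqF // impos.
have e1 : 1 / (w ^+ 2) ^+ m * (w ^+ 2) ^+ i = (w ^+ i / w ^+ m) ^+ 2.
  by rewrite div1r expr_div_n -!exprM mulrC ![(_ * 2)%N]mulnC.
have e2 : (w ^+ 2) ^+ m.+1 / 1 * (w ^+ 2) ^+ i = (w ^+ (i + m.+1)) ^+ 2.
  by rewrite divr1 -exprD -!exprM addnC mulnC.
have e3 : w ^+ 2 * (w ^+ 2) ^+ i = (w ^+ i.+1) ^+ 2.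
  by rewrite -exprS -!exprM mulnC.
rewrite e1 e2 e3 !one_sub_sqr //; last by rewrite normf_div !nw divr1.
have i0 : ('i : algC) != 0 := neq0Ci _.
rewrite /tau; move: c0; move: ('Im _) ('Im (w ^+ (i + _))) ('Im _) => a b c c0.
have wi := w0 i; have wm := w0 m; have wi1 := w0 1; rewrite expr1 in wi1.
rewrite exprD !exprS; move: (w ^+ i) (w ^+ m) wi wm => x y x0 y0.
by field; rewrite i0 c0 wi1 x0 y0.
Qed.

(** For k > m the factor of index m vanishes, and for k >= n - m the one of index n - m - 1, as w^n
    is real. Otherwise every index i satisfies i < m and i + m + 1 < n, and all factors are
    positive. *)
Lemma neg_tau_ge0 m k : (m < n)%N -> (k < n)%N -> 0 <= \prod_(i < k) - tau m i.
Proof.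
move=> lm lk.
have Imr j : 0 <= 'Im (w ^+ j) ^+ 2 by rewrite real_exprn_even_ge0 // Creal_Im.
have [lmk|lkm] := ltnP m k.
  rewrite (bigD1 (Ordinal lmk)) //= /tau divff //.
  have -> : 'Im (1 : algC) = 0 by apply/Creal_ImP/rpred1.
  by rewrite !mul0r oppr0 mul0r.
have [lnk|lkn] := leqP (n - m) k.
  have lj : (n - m.+1 < k)%N by lia.
  rewrite (bigD1 (Ordinal lj)) //= /tau subnK // wn.
  have -> : 'Im (-1 : algC) = 0 by apply/Creal_ImP; rewrite rpredN rpred1.
  by rewrite mulr0 mul0r oppr0 mul0r.
apply: prodr_ge0 => i _; have li := ltn_ord i.
rewrite /tau -mulNr -mulNr divr_ge0 // mulr_ge0 //; last first.
  by apply/ltW/impos; lia.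
have -> : w ^+ i / w ^+ m = (w ^+ (m - i))^-1.
  apply: (mulIf (w0 m)); rewrite divfK // -{2}(subnK (m := i) (n := m)); last lia.
  by rewrite exprD mulrA mulVf ?mul1r.
rewrite ImV nw expr1n divr1 opprK; apply/ltW/impos; lia.
Qed.

(** Each factor of a pair leaves the phase w^(-1); the two pairs give w^(-2 k), which the weight
    (w^2)^k cancels. The two sign changes cancel as well. *)
Lemma hterm_half_root m1 m2 k : (k < n)%N ->
  hterm (w ^+ 2) (1 / (w ^+ 2) ^+ m1) ((w ^+ 2) ^+ m1.+1 / 1)
              (1 / (w ^+ 2) ^+ m2) ((w ^+ 2) ^+ m2.+1 / 1) k =
  (\prod_(i < k) - tau m1 i) * (\prod_(i < k) - tau m2 i).
Proof.
move=> lk; rewrite hterm_pair.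
have e m : qpoch (1 / (w ^+ 2) ^+ m) (w ^+ 2) k * qpoch ((w ^+ 2) ^+ m.+1 / 1) (w ^+ 2) k /
    qpoch (w ^+ 2) (w ^+ 2) k ^+ 2 = (- w^-1) ^+ k * \prod_(i < k) - tau m i.
  rewrite /qpoch !big_mkord.
  rewrite -(prod_frac k (fun i => 1 - 1 / (w ^+ 2) ^+ m * (w ^+ 2) ^+ i)
    (fun i => 1 - (w ^+ 2) ^+ m.+1 / 1 * (w ^+ 2) ^+ i) (fun i => 1 - w ^+ 2 * (w ^+ 2) ^+ i)).
  have -> : (- w^-1) ^+ k = \prod_(i < k) (- w^-1) by rewrite prodr_const card_ord.
  rewrite -big_split; apply: eq_bigr => i _ /=.
  by rewrite pair_factor ?mulrNN //; apply: leq_ltn_trans lk.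
rewrite !e.
have : (w ^+ 2) ^+ k * ((- w^-1) ^+ k * (- w^-1) ^+ k) = 1.
  rewrite -exprD addnn -mul2n exprM sqrrN -exprMn exprVn divff ?expr1n //; exact: (w0 2).
move: ((w ^+ 2) ^+ k) ((- w^-1) ^+ k) => u v uv.
rewrite -[RHS]mul1r -uv; ring.
Qed.

Lemma hterm_sum_gt0 m1 m2 : (m1 < n)%N -> (m2 < n)%N ->
  0 < \sum_(k < n) hterm (w ^+ 2) (1 / (w ^+ 2) ^+ m1) ((w ^+ 2) ^+ m1.+1 / 1)
              (1 / (w ^+ 2) ^+ m2) ((w ^+ 2) ^+ m2.+1 / 1) k.
Proof.
move=> l1 l2; under eq_bigr => k _ do rewrite hterm_half_root //.
rewrite (bigD1 (Ordinal (ltnW n1))) //= ltr_wpDr //.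
  by apply: sumr_ge0 => k _; rewrite mulr_ge0 // neg_tau_ge0.
by rewrite !big_ord0 mulr1 ltr01.
Qed.

End Positivity.

(** * Admissible parameters *)

Definition orbit2 (d s1 s2 : nat) : seq (nat * nat) :=
  [:: (s1, s2); (d - s1, s2); (s1, d - s2); (d - s1, d - s2);
      (s2, s1); (d - s2, s1); (s2, d - s1); (d - s2, d - s1)]%N.

(** Every unit u modulo d carries some member of the orbit to (s1, s2). It is used at u = n modulo
    d; as a boolean it is checked by computation for each admissible pair. *)
Definition unit_stable (d s1 s2 : nat) : bool :=
  all (fun u => coprime u d ==> has (fun x =>
    (u * x.1 == s1 %[mod d]) && (u * x.2 == s2 %[mod d]))
    (orbit2 d s1 s2)) (iota 0 d).

Lemma admissible_data r1 r2 : admissible r1 r2 -> exists s1 s2 : nat,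
  let d := lcd r1 r2 in
  [/\ scaled d r1 = s1 /\ scaled d (1 - r1) = (d - s1)%N :> int,
      scaled d r2 = s2 /\ scaled d (1 - r2) = (d - s2)%N :> int,
      (0 < s1 < d)%N, (0 < s2 < d)%N & unit_stable d s1 s2].
Proof.
have solve r r' : let d := lcd r r' in let f x := `|scaled d x|%N in
  [&& scaled d r == f r, scaled d (1 - r) == (d - f r)%N,
      scaled d r' == f r', scaled d (1 - r') == (d - f r')%N,
      (0 < f r < d)%N, (0 < f r' < d)%N & unit_stable d (f r) (f r')] ->
  exists s1 s2 : nat, let d := lcd r r' in
  [/\ scaled d r = s1 /\ scaled d (1 - r) = (d - s1)%N :> int,
      scaled d r' = s2 /\ scaled d (1 - r') = (d - s2)%N :> int,
      (0 < s1 < d)%N, (0 < s2 < d)%N & unit_stable d s1 s2].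
  move=> d f /and5P [/eqP a /eqP b /eqP e /eqP g /and3P [h i j]].
  by exists (f r), (f r').
case=> [[]|].
  by rewrite !inE => /or4P [] /eqP -> /or4P [] /eqP ->; apply: solve; vm_compute.
by rewrite !inE => /or4P [] /eqP [-> ->]; apply: solve; vm_compute.
Qed.

(** * The place of Z(q) at a primitive root of unity *)

Section CyclotomicPlace.
Variables (n : nat) (z : algC).
Hypothesis pz : n.-primitive_root z.
Implicit Types A B : {poly int}.

Definition eval_at A : algC := (map_poly intr A).[z].

Lemma eval_atM A B : eval_at (A * B) = eval_at A * eval_at B.
Proof. by rewrite /eval_at rmorphM hornerM. Qed.
Lemma eval_atD A B : eval_at (A + B) = eval_at A + eval_at B.
Proof. by rewrite /eval_at rmorphD hornerD. Qed.
Lemma eval_atN A : eval_at (- A) = - eval_at A.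
Proof. by rewrite /eval_at rmorphN hornerN. Qed.
Lemma eval_at1 : eval_at 1 = 1.
Proof. by rewrite /eval_at rmorph1 hornerC. Qed.
Lemma eval_at0 : eval_at 0 = 0.
Proof. by rewrite /eval_at rmorph0 horner0. Qed.
Lemma eval_at_neq0 A : eval_at A != 0 -> A != 0.
Proof. by apply: contraNneq => ->; rewrite eval_at0. Qed.

Lemma eval_at_Cyclotomic : eval_at 'Phi_n = 0.
Proof.
apply/eqP; change (root (map_poly intr 'Phi_n) z).
by rewrite (Cintr_Cyclotomic pz) root_cyclotomic.
Qed.

(** As 'Phi_n is monic, Euclidean division stays in Z[q]; the remainder vanishes at z and is shorter
    than the minimal polynomial of z. *)
Lemma eval_at_eq0 A : eval_at A = 0 -> exists B, A = 'Phi_n * B.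
Proof.
move=> eA; have mP := Cyclotomic_monic n.
pose Q := Pdiv.Ring.rdivp A 'Phi_n; pose R := Pdiv.Ring.rmodp A 'Phi_n.
have eQ : A = Q * 'Phi_n + R := Pdiv.RingMonic.rdivp_eq mP A.
have eR : eval_at R = 0 by have := eA;
  rewrite eQ eval_atD eval_atM eval_at_Cyclotomic mulr0 add0r.
suff R0 : R = 0 by exists Q; rewrite eQ R0 addr0 mulrC.
have sR : (size R < size 'Phi_n)%N by rewrite Pdiv.Ring.ltn_rmodpN0 // monic_neq0.
have [f [ef mf dvf]] := minCpolyP z.
have hR : root (map_poly (ratr : rat -> algC) (map_poly (intr : int -> rat) R)) z.
  rewrite /root -map_poly_comp; apply/eqP; rewrite -[RHS]eR /eval_at; congr (_.[z]).
  by apply: eq_map_poly => b; rewrite /= rmorph_int.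
rewrite dvf in hR.
have sz : size f = size 'Phi_n.
  have := congr1 (fun q : {poly algC} => size q) ef.
  rewrite /= (minCpoly_cyclotomic pz) -(Cintr_Cyclotomic pz) size_map_poly.
  by rewrite size_map_inj_poly //; exact: intr_inj.
apply/eqP; apply: contraTT hR => nR.
have nR' : map_poly (intr : int -> rat) R != 0 by rewrite map_poly_eq0_id0 // intr_eq0
  lead_coef_eq0.
apply/negP => /(dvdp_leq nR'); rewrite sz leqNgt size_map_inj_poly ?sR //.
exact: intr_inj.
Qed.

Definition value_at (x : Zq) (c : algC) := exists A B,
  [/\ eval_at B != 0, x = tofrac A / tofrac B & c = eval_at A / eval_at B].

Let nF A : eval_at A != 0 -> tofrac A != 0 :> Zq.
Proof. by move=> /eval_at_neq0; rewrite tofrac_eq0. Qed.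

Lemma value_at_poly A : value_at (tofrac A) (eval_at A).
Proof. by exists A, 1; rewrite eval_at1 oner_neq0 tofrac1 !divr1. Qed.

Lemma cyclotomic_place : place value_at (tofrac 'Phi_n).
Proof.
split.
- by have := value_at_poly 0; rewrite tofrac0 eval_at0.
- by have := value_at_poly 1; rewrite tofrac1 eval_at1.
- move=> x y a b [A [B [nB -> ->]]] [A' [B' [nB' -> ->]]].
  exists (A * B' + A' * B), (B * B'); rewrite eval_atD !eval_atM mulf_neq0 //; split=> //.
    by rewrite tofracD !tofracM addf_div ?nF.
  by rewrite addf_div.
- move=> x a [A [B [nB -> ->]]]; exists (- A), B; rewrite eval_atN tofracN; split=> //.
    by rewrite mulNr.
  by rewrite mulNr.
- move=> x y a b [A [B [nB -> ->]]] [A' [B' [nB' -> ->]]].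
  exists (A * A'), (B * B'); rewrite !eval_atM mulf_neq0 //; split=> //.
    by rewrite !tofracM mulf_div.
  by rewrite mulf_div.
- move=> x a [A [B [nB -> ->]]]; rewrite mulf_eq0 invr_eq0 negb_or => /andP [nA _].
  by exists B, A; rewrite !invfM !invrK ![_^-1 * _]mulrC.
- move=> x a b [A [B [nB -> ->]]] [A' [B' [nB' e ->]]].
  have : A * B' = A' * B.
    apply/eqP; rewrite -tofrac_eq !tofracM -eqr_div ?nF //; exact/eqP.
  by move/(congr1 eval_at); rewrite !eval_atM => /eqP; rewrite -eqr_div // => /eqP.
- by have := value_at_poly 'Phi_n; rewrite eval_at_Cyclotomic.
- by rewrite tofrac_eq0 monic_neq0 // Cyclotomic_monic.
- move=> x [A [B [nB -> /esym/eqP]]].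
  rewrite mulf_eq0 invr_eq0 (negPf nB) orbF => /eqP /eval_at_eq0 [A' ->].
  exists (tofrac A' / tofrac B), (eval_at A' / eval_at B); split; first by exists A', B.
  by rewrite tofracM mulrA.
Qed.

Lemma value_at_qvar : value_at qvar z.
Proof. by have := value_at_poly 'X; rewrite /eval_at map_polyX hornerX. Qed.

(** For coprimality in Z[q]: a common divisor D of 'Phi_n ^+ 3 and B is nonzero at z, because B is.
    Hence in 'Phi_n ^+ 3 = E * D the factors 'Phi_n can be removed from E one at a time, until D
    divides 1. *)
Lemma zqcong_eqmod (F G : Zq) : eqmod value_at (tofrac 'Phi_n) 3 F G -> zqcong ('Phi_n ^+ 3) F G.
Proof.
move=> [x [[c [A [B [nB -> _]]]] e]]; exists ('Phi_n ^+ 3 * A), B; split.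
- exact: eval_at_neq0.
- by rewrite e tofracM tofracXn mulrA.
- by exists A; rewrite mulrC.
move=> D [E eD] [G' eB].
have nD : eval_at D != 0 by apply: contraNneq nB => h; rewrite eB eval_atM h mulr0.
have nP : 'Phi_n != 0 by rewrite monic_neq0 // Cyclotomic_monic.
have step k E' : 'Phi_n ^+ k.+1 = E' * D -> exists E'', 'Phi_n ^+ k = E'' * D.
  move=> h; have : eval_at E' = 0.
    apply/eqP; have /eqP := congr1 eval_at h;
      rewrite exprS !eval_atM eval_at_Cyclotomic mul0r eq_sym.
    by rewrite mulf_eq0 (negPf nD) orbF.
  by move/eval_at_eq0 => [E'' e']; exists E''; apply: (mulfI nP); rewrite -exprS h e' mulrA.
have [E2 e2] := step _ _ eD; have [E1 e1] := step _ _ e2; have [E0 e0] := step _ _ e1.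
by apply/unitrP; exists E0; rewrite -e0 expr0 mulrC -e0.
Qed.

End CyclotomicPlace.

Definition Hterm (F : fieldType) (d s1 s2 : nat) (q : F) k :=
  hterm (q ^+ d) (q ^+ s1) (q ^+ (d - s1)) (q ^+ s2) (q ^+ (d - s2)) k.

Lemma H_Hterm (F : fieldType) r1 r2 (s1 s2 : nat) N (q : F) :
  let d := lcd r1 r2 in
  scaled d r1 = s1 /\ scaled d (1 - r1) = (d - s1)%N :> int ->
  scaled d r2 = s2 /\ scaled d (1 - r2) = (d - s2)%N :> int ->
  H r1 r2 N q = \sum_(0 <= k < N) Hterm d s1 s2 q k.
Proof.
move=> d [e1 e2] [e3 e4]; rewrite /H -/d e1 e2 e3 e4.
by apply: eq_bigr => k _; rewrite /Hterm /hterm exprM.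
Qed.

Lemma Hterm_orbit (F : fieldType) d s1 s2 x (q : F) k : (s1 <= d)%N -> (s2 <= d)%N ->
  x \in orbit2 d s1 s2 -> Hterm d x.1 x.2 q k = Hterm d s1 s2 q k.
Proof.
move=> l1 l2; rewrite !inE /Hterm !hterm_pair.
by do 7?[case/orP]; move=> /eqP -> /=; rewrite ?subKn //; ring.
Qed.

(** * From blocks to the quotient of truncated sums *)

Section Final.
Variables (K : fieldType) (hv : K -> algC -> Prop) (eps : K).
Hypothesis pl : place hv eps.

Lemma hv_one_sub_ratio t a b : hv t 1 -> (forall i, (0 < i)%N -> t ^+ i != 1) ->
  (0 < b)%N -> hv ((1 - t ^+ a) / (1 - t ^+ b)) (a%:R / b%:R).
Proof.
move=> ht nt b0; have nt1 : 1 - t != 0 by rewrite subr_eq0 eq_sym; have := nt 1%N isT.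
have hg m : hv (geom m t) m%:R.
  by rewrite -(geom1 algC m); apply: (hv_sum pl) => i _; apply: (hvX pl).
rewrite -!geomE invfM mulrACA divff // mul1r.
by apply: (hvF pl) => //; rewrite pnatr_eq0 -lt0n.
Qed.

(** For t reducing to 1, quotients (1 - t^a) / (1 - t^b) reduce to a / b, so the summand reduces to
    that of a classical 4F3 series at 1. Applied to t = q^(n^2), it makes H(N; q^(n^2)) a unit. *)
Lemma hv_Hterm_gt0 d s1 s2 t k : hv t 1 -> (forall i, (0 < i)%N -> t ^+ i != 1) ->
  (0 < s1 < d)%N -> (0 < s2 < d)%N -> exists2 v, 0 < v & hv (Hterm d s1 s2 t k) v.
Proof.
move=> ht nt /andP [s10 s1d] /andP [s20 s2d].
have d0 : (0 < d)%N by apply: leq_ltn_trans s1d.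
have h s : (0 < s)%N -> exists2 v, 0 < v & hv (qpoch (t ^+ s) (t ^+ d) k / qpoch (t ^+ d) (t ^+
  d) k) v.
  move=> s0; exists (\prod_(i < k) ((s + d * i)%:R / (d + d * i)%:R)).
    by apply: prodr_gt0 => i _; rewrite divr_gt0 // ltr0n addn_gt0 ?s0 ?d0.
  rewrite /qpoch !big_mkord -prodf_div; apply: (hv_prod pl) => i _.
  rewrite -!exprM -!exprD; apply: hv_one_sub_ratio => //; by rewrite addn_gt0 d0.
have [v1 p1 h1] := h _ s10; have [v2 p2 h2] := h _ s20.
have [|v3 p3 h3] := h (d - s1)%N; first by rewrite subn_gt0.
have [|v4 p4 h4] := h (d - s2)%N; first by rewrite subn_gt0.
exists (v1 * v3 * (v2 * v4) * 1); first by rewrite !mulr_gt0 // ltr01.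
rewrite /Hterm hterm_pair expr2 !invfM.
have e (a b c : K) : a * b * (c * c) = (a * c) * (b * c) by ring.
rewrite !e; apply: (hvM pl); last by do 2 apply: (hv1n pl).
by apply: (hvM pl); apply: (hvM pl).
Qed.

Variables (n d s1 s2 : nat) (q : K) (w z : algC).
Hypotheses (n1 : (1 < n)%N) (wn : w ^+ n = -1).
Hypothesis wpos : forall j, (0 < j < n)%N -> 0 < imR (w ^+ j).
Hypotheses (hq : hv q z) (zn : z ^+ n = 1) (zd : z ^+ d = w ^+ 2).
Hypothesis q_inj : forall i j, q ^+ i = q ^+ j -> i = j.
Hypotheses (cnd : coprime n d) (b1 : (0 < s1 < d)%N) (b2 : (0 < s2 < d)%N).
Hypothesis us : unit_stable d s1 s2.

Let pw : n.-primitive_root (w ^+ 2) := half_root_prim n1 wn wpos.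
Let z0 : z != 0.
Proof.
apply/eqP => e; move: zn; rewrite e expr0n gtn_eqF ?(ltnW n1) //.
by move/eqP; rewrite eq_sym oner_eq0.
Qed.
Let q0 : q != 0 := hv_neq0 pl hq z0.
Let hp : hv (q ^+ d) (w ^+ 2). Proof. by rewrite -zd; apply: (hvX pl). Qed.
Let q1 i : (0 < i)%N -> q ^+ i != 1.
Proof.
by move=> i0; apply/eqP; rewrite -(expr0 q) => /q_inj e; rewrite e in i0.
Qed.
Let hQ j : hv (q ^+ (n * j)) 1.
Proof. by have := hvX pl (n * j) hq; rewrite [z ^+ _]exprM zn expr1n. Qed.

(** Euclidean division of n x by d, with remainder s; the bound on m comes from x < d. *)
Lemma dilation x s : (0 < s < d)%N -> (n * x = s %[mod d])%N -> (x < d)%N ->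
  exists2 m, (m < n)%N & (s + d * m = n * x)%N.
Proof.
move=> /andP [s0 sd] e xd; have d0 : (0 < d)%N by apply: leq_ltn_trans sd.
exists (n * x %/ d)%N; first by rewrite ltn_divLR // ltn_pmul2l // ltnW.
by rewrite mulnC addnC [RHS](divn_eq _ d) e modn_small.
Qed.

(** An equality of powers would force d to divide n x r, although r is prime to d and n x is
    congruent to s, not to 0. The cases r = 1 and r = n serve a = q^(n x) and a^n. *)
Lemma indep_dilation s x m r : (0 < s < d)%N -> (s + d * m = n * x)%N -> coprime r d ->
  indep (q ^+ (n * x * r)) (q ^+ d).
Proof.
move=> /andP [s0 sd] e crd i j; apply/eqP; rewrite -!exprM -exprD => /q_inj h.
have : (d %| n * x * r)%N by rewrite -(@dvdn_addl (d * i)) ?dvdn_mulr // h dvdn_mulr.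
rewrite Gauss_dvdl 1?coprime_sym // -e dvdn_addl ?dvdn_mulr //.
by move/dvdn_leq => /(_ s0); rewrite leqNgt sd.
Qed.

Lemma dwork_block : exists h, [/\ 0 < h, hv (\sum_(k < n) Hterm d s1 s2 q k) h &
  forall l, eqmod hv eps 3 (\sum_(k < n) Hterm d s1 s2 q (n * l + k)%N)
    (Hterm d s1 s2 (q ^+ (n ^ 2)) l * \sum_(k < n) Hterm d s1 s2 q k)].
Proof.
have [s10 s1d] := andP b1; have [s20 s2d] := andP b2.
have d0 : (0 < d)%N by apply: leq_ltn_trans s1d.
have [x [m1 [m2 [xo lm1 lm2 [e1 e2] [lx1 lx2]]]]] : exists x m1 m2,
   [/\ x \in orbit2 d s1 s2, (m1 < n)%N, (m2 < n)%N,
     (s1 + d * m1 = n * x.1)%N /\ (s2 + d * m2 = n * x.2)%N & (x.1 <= d)%N /\ (x.2 <= d)%N].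
  (* Only the class of n modulo d matters, so stability is applied to its remainder. *)
  have /(allP us) : (n %% d)%N \in iota 0 d by rewrite mem_iota /= add0n ltn_pmod.
  rewrite coprime_modl cnd implyTb => /hasP [x xo /andP [/eqP f1 /eqP f2]].
  rewrite modnMml in f1; rewrite modnMml in f2.
  have [lx1 lx2] : (x.1 < d)%N /\ (x.2 < d)%N.
    by move: xo; rewrite !inE; do 7?[case/orP]; move=> /eqP -> /=; split=> //; lia.
  have [m1 lm1 g1] := dilation b1 f1 lx1; have [m2 lm2 g2] := dilation b2 f2 lx2.
  by exists x, m1, m2; split=> //; split; apply: ltnW.
set p := q ^+ d.
have aE s x' m : (s + d * m = n * x')%N -> q ^+ (n * x') / p ^+ m = q ^+ s.
  by move=> <-; rewrite exprD exprM mulfK // !expf_neq0.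
have bE s x' m : (s <= d)%N -> (s + d * m = n * x')%N -> p ^+ m.+1 / q ^+ (n * x') = q ^+ (d - s).
  move=> sd e; have -> : p ^+ m.+1 = q ^+ (d - s) * q ^+ (n * x').
    by rewrite -exprD -e /p -exprM; congr (_ ^+ _); lia.
  by rewrite mulfK // expf_neq0.
have PE : (p ^+ n) ^+ n = (q ^+ (n ^ 2)) ^+ d by rewrite /p -!exprM; congr (_ ^+ _); lia.
have AE x' : (q ^+ (n * x')) ^+ n = (q ^+ (n ^ 2)) ^+ x'.
  by rewrite -!exprM; congr (_ ^+ _); lia.
have PAE x' : (x' <= d)%N -> (q ^+ (n ^ 2)) ^+ d / (q ^+ (n ^ 2)) ^+ x' =
  (q ^+ (n ^ 2)) ^+ (d - x').
  by move=> lx; rewrite -[in LHS](subnK lx) exprD mulfK // !expf_neq0.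
have hp1 i : (0 < i)%N -> p ^+ i != 1 by move=> i0; rewrite -exprM q1 // muln_gt0 d0.
have hQ2 : hv (q ^+ (n ^ 2)) 1 by rewrite -mulnn.
have Q1 i : (0 < i)%N -> (q ^+ (n ^ 2)) ^+ i != 1.
  by move=> i0; rewrite -exprM q1 // muln_gt0 i0 expn_gt0 ltnW.
have cE k : Hterm d s1 s2 q k = hterm p (q ^+ (n * x.1) / p ^+ m1) (p ^+ m1.+1 / q ^+ (n * x.1))
    (q ^+ (n * x.2) / p ^+ m2) (p ^+ m2.+1 / q ^+ (n * x.2)) k.
  by rewrite (aE s1) // (aE s2) // (bE s1) // 1?ltnW // (bE s2) // ltnW.
have hpi : indep (q ^+ (n * x.1)) p /\ indep (q ^+ (n * x.1) ^+ n) p.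
  split; first by rewrite -[(n * _)%N]muln1; apply: indep_dilation b1 e1 (coprime1n d).
  by rewrite -exprM; apply: indep_dilation b1 e1 cnd.
have hpi2 : indep (q ^+ (n * x.2)) p /\ indep (q ^+ (n * x.2) ^+ n) p.
  split; first by rewrite -[(n * _)%N]muln1; apply: indep_dilation b2 e2 (coprime1n d).
  by rewrite -exprM; apply: indep_dilation b2 e2 cnd.
exists (\sum_(k < n) hterm (w ^+ 2) (1 / (w ^+ 2) ^+ m1) ((w ^+ 2) ^+ m1.+1 / 1)
              (1 / (w ^+ 2) ^+ m2) ((w ^+ 2) ^+ m2.+1 / 1) k); split.
- exact: hterm_sum_gt0.
- apply: (hv_sum pl) => k _; rewrite cE /hterm.
  have wX j : (w ^+ 2) ^+ j != 0 by rewrite expf_neq0 // (prim_neq0 pw).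
  have hq_ a b : hv a b -> hv (qpoch a p k) (qpoch b (w ^+ 2) k).
    move=> hab; rewrite /qpoch !big_mkord; apply: (hv_prod pl) => i _.
    by apply: (hvB pl (hv1 pl)); apply: (hvM pl) => //; apply: (hvX pl).
  have ha x' m : hv (q ^+ (n * x') / p ^+ m) (1 / (w ^+ 2) ^+ m).
    by apply: (hvF pl) => //; apply: (hvX pl).
  have hb x' m : hv (p ^+ m.+1 / q ^+ (n * x')) ((w ^+ 2) ^+ m.+1 / 1).
    by apply: (hvF pl) => //; [apply: (hvX pl) | apply: oner_neq0].
  apply: (hvM pl); last exact: (hvX pl).
  apply: (hvF pl); first by do 3 (apply: (hvM pl); last exact: hq_); exact: hq_.
    by apply: (hvX pl); apply: hq_.
  rewrite expf_neq0 // /qpoch big_mkord; apply/prodf_neq0 => i _.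
  rewrite -exprS subr_eq0 -(expr0 (w ^+ 2)) (prim_inj pw) //; first exact: ltnW.
  exact: leq_ltn_trans (ltn_ord k).
move=> l.
(* The block formula yields c' with exponents x.1 and x.2; they are exchanged for s1 and s2 by the
   symmetries of the orbit. *)
have c'E : Hterm d s1 s2 (q ^+ (n ^ 2)) l =
    hterm ((p ^+ n) ^+ n) (q ^+ (n * x.1) ^+ n) ((p ^+ n) ^+ n / q ^+ (n * x.1) ^+ n)
      (q ^+ (n * x.2) ^+ n) ((p ^+ n) ^+ n / q ^+ (n * x.2) ^+ n) l.
  by rewrite -(Hterm_orbit _ _ _ _ xo) 1?ltnW // PE !AE !PAE.
have rc : regular hv (Hterm d s1 s2 (q ^+ (n ^ 2)) l).
  by have [v _ hvv] := hv_Hterm_gt0 l hQ2 Q1 b1 b2; exists v.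
rewrite c'E in rc *.
have := block_sum pl pw hp (hQ x.1) (hQ x.2) lm1 lm2 hpi.1 hpi.2 hpi2.1 hpi2.2 hp1 rc.
under eq_bigr => k _ do rewrite -cE.
by under [X in eqmod _ _ _ _ (_ * X)]eq_bigr => k _ do rewrite -cE.
Qed.

Lemma sum_blocks (f : nat -> K) N :
  \sum_(0 <= k < N * n) f k = \sum_(0 <= l < N) \sum_(k < n) f (n * l + k)%N.
Proof.
elim: N => [|N IH]; first by rewrite mul0n !big_nil.
rewrite big_nat_recr //= -IH (@big_cat_nat _ _ _ (N * n)%N) //=;
  last by rewrite leq_mul2r leqnSn orbT.
congr (_ + _); rewrite -{1}[(N * n)%N]add0n big_addn mulSn addnK big_mkord.
by apply: eq_bigr => k _; rewrite addnC mulnC.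
Qed.

Lemma dwork_quotient A B : (0 < A)%N -> (0 < B)%N ->
  let S N t := \sum_(0 <= k < N) Hterm d s1 s2 t k in
  eqmod hv eps 3 (S (A * n)%N q / S (B * n)%N q) (S A (q ^+ (n ^ 2)) / S B (q ^+ (n ^ 2))).
Proof.
move=> A0 B0 S; have [h [h0 hh blk]] := dwork_block.
set Q := q ^+ (n ^ 2).
have hQ2 : hv Q 1 by rewrite /Q -mulnn.
have Q1 i : (0 < i)%N -> Q ^+ i != 1.
  by move=> i0; rewrite -exprM q1 // muln_gt0 i0 expn_gt0 ltnW.
have hS N : (0 < N)%N -> exists2 v, 0 < v & hv (S N Q) v.
  elim: N => // -[|N] IH _; rewrite /S big_nat_recr //=.
    have [v v0 hvv] := hv_Hterm_gt0 0 hQ2 Q1 b1 b2.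
    by exists v => //; rewrite big_nil add0r.
  have [v v0 hvv] := hv_Hterm_gt0 N.+1 hQ2 Q1 b1 b2; have [u u0 hu] := IH isT.
  by exists (u + v); [apply: addr_gt0 | apply: (hvD pl)].
have key N : eqmod hv eps 3 (S (N * n)%N q) (S N Q * \sum_(k < n) Hterm d s1 s2 q k).
  by rewrite /S sum_blocks mulr_suml; apply: (eqmod_sum pl) => l _; apply: blk.
have [vA vA0 hA] := hS A A0; have [vB vB0 hB] := hS B B0.
have hAn := hvM pl hA hh; have hBn := hvM pl hB hh.
have nB : vB * h != 0 by rewrite mulf_neq0 // gt_eqF.
have hn0 : \sum_(k < n) Hterm d s1 s2 q k != 0 by apply: (hv_neq0 pl hh); rewrite gt_eqF.
(* Extending the fraction by H(n; q) makes its numerator and denominator the right-hand sides of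
   [key]. *)
have -> : S A Q / S B Q = (S A Q * \sum_(k < n) Hterm d s1 s2 q k) /
    (S B Q * \sum_(k < n) Hterm d s1 s2 q k).
  by rewrite invfM mulrACA divff // mulr1.
have hBn' := eqmod_hv pl (key B) hBn.
apply: (eqmodM pl) => //.
- by exists (vA * h).
- by exists (vB * h)^-1; apply: (hvV pl).
- exact: (eqmodV pl hBn' hBn nB).
Qed.
End Final.

Theorem mainTheorem1 (r1 r2 : rat) (A B n : nat) :
  admissible r1 r2 ->
  (0 < A)%N -> (0 < B)%N -> (1 < n)%N -> coprime n (lcd r1 r2) ->
  zqcong ('Phi_n ^+ 3)
    (H r1 r2 (A * n)%N qvar / H r1 r2 (B * n)%N qvar)
    (H r1 r2 A (qvar ^+ (n ^ 2)%N) / H r1 r2 B (qvar ^+ (n ^ 2)%N)).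
Proof.
move=> /admissible_data [s1 [s2 [e1 e2 b1 b2 us]]] A0 B0 n1 cnd.
set d := lcd r1 r2 in b1 b2 us cnd.
have [w wn wpos] := half_root_exists n1.
have pw := half_root_prim n1 wn wpos.
have d0 : (0 < d)%N by case/andP: b1 => _; apply: leq_ltn_trans.
(* All primitive n-th roots of unity are zeros of 'Phi_n, so z is free. With u inverse to d modulo
   n, z = w^(2 u) gives q^d, not q, the value w^2 at which positivity is known. *)
have [u cu ud] : exists2 u, coprime u n & (u * d = 1 %[mod n])%N.
  case: (egcdnP n d0) => u v e _.
  have {}e : (u * d = v * n + 1)%N by rewrite e gcdnC (eqP cnd).
  exists u; last by rewrite e modnMDl.
  have : coprime (u * d) n by rewrite e -coprime_modl modnMDl coprime_modl coprime1n.
  by rewrite coprimeMl => /andP [].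
pose z := (w ^+ 2) ^+ u.
have pz : n.-primitive_root z by rewrite prim_root_exp_coprime.
have zd : z ^+ d = w ^+ 2.
  by rewrite -exprM -(prim_expr_mod pw) ud (prim_expr_mod pw) expr1.
apply: (zqcong_eqmod pz); rewrite !(H_Hterm _ _ e1 e2).
have q_inj i j : qvar ^+ i = qvar ^+ j -> i = j.
  rewrite /qvar -!tofracXn => /eqP; rewrite tofrac_eq => /eqP.
  by move/(congr1 (fun P : {poly int} => size P)); rewrite !size_polyXn => -[].
exact: (dwork_quotient (cyclotomic_place pz) n1 wn wpos (value_at_qvar z)
  (prim_expr_order pz) zd q_inj cnd b1 b2 us A0 B0).
Qed.
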